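(* Let $F$ be a field of $\operatorname{char}(F)=2$. If $u(F)$ is finite, then $sl_2^n(F)$ is finite for any positive integer $n$.
   Context: Let $F$ be a field of characteristic $2$. The $u$-invariant $u(F)$ is the maximal dimension of a nonsingular anisotropic quadratic form over $F$. Differential forms: $\Omega_F^1$ is the $F$-vector space of absolute differentials, generated by symbols $da$ ($a\in F$) with $d(a+b)=da+db$, $d(ab)=a\,db+b\,da$; $\Omega_F^k=\bigwedge^k\Omega_F^1$ with $\Omega_F^0=F$ and $\Omega_F^k=0$ for $k<0$; $d:\Omega_F^k\to\Omega_F^{k+1}$ is $d(a_0\,da_1\wedge\dots\wedge da_k)=da_0\wedge da_1\wedge\dots\wedge da_k$. The Artin-Schreier map $\wp:\Omega_F^k\to\Omega_F^k/d\Omega_F^{k-1}$ is the group homomorphism with $\alpha\frac{d\beta_1}{\beta_1}\wedge\dots\wedge\frac{d\beta_k}{\beta_k}\mapsto(\alpha^2-\alpha)\frac{d\beta_1}{\beta_1}\wedge\dots\wedge\frac{d\beta_k}{\beta_k}$ ($\alpha \in F$, $\beta_i\in F^\times$). The Kato-Milne cohomology group is $H_2^{k+1}(F)=\operatorname{coker}(\wp)$. It is generated by the classes of the decomposable differential forms $\alpha\frac{d\beta_1}{\beta_1}\wedge\dots\wedge\frac{d\beta_k}{\beta_k}$. Symbol length: the symbol length of an element of $H_2^n(F)$ is the minimal number of decomposable differential forms required to express it (as a sum of their classes); $sl_2^n(F)$ is the supremum of the symbol lengths of all elements of $H_2^n(F)$. *)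

(* Defs.v *)
From HB Require Import structures.
From mathcomp Require Import all_boot all_order all_algebra.
From mathcomp Require Import generic_quotient ring_quotient ring.
From mathcomp.multinomials Require Import freeg.
From mathcomp.classical Require Import boolp classical_sets.
From mathcomp.reals Require Import constructive_ereal.
Set Implicit Arguments.
Unset Strict Implicit.
Unset Printing Implicit Defensive.
Import GRing.Theory.
Local Open Scope ring_scope.
Local Open Scope quotient_scope.

(* The least upper bound, in the naturals extended by +oo. *)
Definition nat_sup (A : set nat) : \bar nat :=
  match pselect (exists N, `[< ubound A N >]) with
  | left bA => (ex_minn bA)%:E
  | right _ => +oo%E
  end.

Section QuadraticForms.
Variables (F : fieldType) (m : nat).
Implicit Type q : 'rV[F]_m -> F.

Definition polar q (u v : 'rV[F]_m) : F := q (u + v) - q u - q v.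

(* polar q is symmetric, so linearity in one argument is bilinearity. *)
Definition quadratic_form q : Prop :=
  (forall a v, q (a *: v) = a ^+ 2 * q v) /\
  (forall u a v w, polar q u (a *: v + w) = a * polar q u v + polar q u w).

Definition nonsingular q : Prop :=
  forall u, (forall v, polar q u v = 0) -> u = 0.

Definition anisotropic q : Prop := forall v, q v = 0 -> v = 0.

End QuadraticForms.

Definition u_invariant (F : fieldType) : \bar nat :=
  nat_sup [set m | exists q : 'rV[F]_m -> F,
    [/\ quadratic_form q, nonsingular q & anisotropic q]].

Definition upd (k : nat) (T : Type) (t : {ffun 'I_k -> T}) (i : 'I_k) (x : T) :
    {ffun 'I_k -> T} :=
  [ffun j => if j == i then x else t j].

Definition fcons (k : nat) (T : Type) (x : T) (t : {ffun 'I_k -> T}) :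
    {ffun 'I_k.+1 -> T} :=
  [ffun i => oapp t x (unlift ord0 i)].

Section QuotientModule.
Variables (R : nzRingType) (V : lmodType R) (S : V -> Prop).

Definition spanned (v : V) : Prop :=
  forall P : V -> Prop, P 0 -> (forall a u w, P u -> P w -> P (a *: u + w)) ->
  (forall s, S s -> P s) -> P v.

Definition spanb (v : V) : bool := `[< spanned v >].

Lemma spanb_lin a u v : spanb u -> spanb v -> spanb (a *: u + v).
Proof.
move=> /asboolP su /asboolP sv; apply/asboolP => P P0 PL PS.
by apply: (PL); [exact: su P P0 PL PS|exact: sv P P0 PL PS].
Qed.

Lemma spanb0 : spanb 0.
Proof. by apply/asboolP => P. Qed.

Lemma spanb_zmod : zmod_closed spanb.
Proof.
split; first exact: spanb0.
by move=> u v su sv; rewrite addrC -scaleN1r; apply: spanb_lin.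
Qed.

HB.instance Definition _ := GRing.isZmodClosed.Build V spanb spanb_zmod.

Definition quotmod : Type :=
  Quotient.quot (GRing.ZmodClosed.clone V spanb _).
HB.instance Definition _ := EqQuotient.on quotmod.
HB.instance Definition _ := GRing.Zmodule.on quotmod.
HB.instance Definition _ := ZmodQuotient.on quotmod.

Definition qcls (v : V) : quotmod := \pi_quotmod v.

Lemma qcls_is_zmod : zmod_morphism qcls.
Proof. exact: (@pi_is_zmod_morphism _ _ _ quotmod). Qed.
HB.instance Definition _ :=
  GRing.isZmodMorphism.Build V quotmod qcls qcls_is_zmod.

Lemma qclsB u v : qcls (u - v) = qcls u - qcls v.
Proof. exact: raddfB. Qed.

Lemma qcls_eq u v : (qcls u == qcls v) = spanb (u - v).
Proof. by rewrite /qcls -Quotient.idealrBE. Qed.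

Lemma qclsK (q : quotmod) : qcls (repr q) = q.
Proof. exact: reprK. Qed.

Definition qscale (a : R) (q : quotmod) : quotmod := qcls (a *: repr q).

Lemma qscaleE a v : qscale a (qcls v) = qcls (a *: v).
Proof.
apply/eqP; rewrite qcls_eq -scalerBr -[_ *: _]addr0.
by apply: spanb_lin (spanb0); rewrite -qcls_eq qclsK.
Qed.

Fact qscaleA a b q : qscale a (qscale b q) = qscale (a * b) q.
Proof. by rewrite -[q]qclsK !qscaleE scalerA. Qed.
Fact qscale1 : left_id 1 qscale.
Proof. by move=> q; rewrite -[q]qclsK !qscaleE scale1r. Qed.
Fact qscaleDr : right_distributive qscale +%R.
Proof.
move=> a p q; rewrite -[q]qclsK -[p]qclsK -raddfD !qscaleE -raddfD.
by rewrite scalerDr.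
Qed.
Fact qscaleDl v : {morph qscale^~ v : a b / a + b}.
Proof. by move=> a b; rewrite -[v]qclsK !qscaleE -raddfD scalerDl. Qed.

HB.instance Definition _ :=
  GRing.Zmodule_isLmodule.Build R quotmod qscaleA qscale1 qscaleDr qscaleDl.

Lemma qclsZ a v : qcls (a *: v) = a *: qcls v.
Proof. exact/esym/qscaleE. Qed.

Lemma qcls0 v : S v -> qcls v = 0.
Proof.
move=> Sv; rewrite -(raddf0 qcls); apply/eqP; rewrite qcls_eq subr0.
by apply/asboolP => P _ _; apply.
Qed.

Lemma quotmod_lift (G : zmodType) (g : {additive V -> G}) :
  (forall a s, S s -> g (a *: s) = 0) ->
  exists h : {additive quotmod -> G}, forall v, h (qcls v) = g v.
Proof.
move=> gS.
have g0 v : spanb v -> g v = 0.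
  move=> /asboolP sv; rewrite -[v]scale1r; move: 1.
  apply: (sv (fun v => forall c, g (c *: v) = 0)) => [c|a u w gu gw c|s /gS].
    by rewrite scaler0 raddf0.
    by rewrite scalerDr raddfD /= scalerA gu gw addr0.
  exact.
pose h (q : quotmod) := g (repr q).
have hE v : h (qcls v) = g v.
  apply/eqP; rewrite -subr_eq0 -raddfB /=; apply/eqP/g0.
  by rewrite -qcls_eq qclsK.
have hD : zmod_morphism h.
  move=> p q; rewrite -[p]qclsK -[q]qclsK -raddfB !hE.
  exact: raddfB.
pose hM := GRing.isZmodMorphism.Build _ _ h hD.
pose hA : {additive quotmod -> G} := HB.pack h hM.
by exists hA.
Qed.

End QuotientModule.

Section FreeModule.
Variables (R : nzRingType) (K : choiceType).

Lemma freegZ (a b : R) (x : K) : a *: << b *g x >> = << (a * b) *g x >>.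
Proof. by apply/eqP/freeg_eqP => y; rewrite coeffZ !coeffU mulrA. Qed.

Definition fsum (G : zmodType) (g : R -> K -> G) (D : {freeg K / R}) : G :=
  \sum_(x <- dom D) g (coeff x D) x.

Lemma fsum_widen (G : zmodType) (g : R -> K -> G) D (s : seq K) :
  (forall x, g 0 x = 0) -> uniq s -> {subset dom D <= s} ->
  fsum g D = \sum_(x <- s) g (coeff x D) x.
Proof.
move=> g0 us sub; rewrite (bigID (mem (dom D))) /= [X in _ + X]big1 ?addr0.
  rewrite -big_filter; apply: perm_big; apply: uniq_perm.
  - exact: uniq_dom.
  - exact: filter_uniq.
  - by move=> x; rewrite mem_filter andb_idr //; apply: sub.
by move=> x xD; rewrite coeff_outdom.
Qed.

Lemma fsumP (G : zmodType) (g : R -> K -> G) :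
  (forall a b x, g (a + b) x = g a x + g b x) ->
  zmod_morphism (fsum g) /\ forall c x, fsum g << c *g x >> = g c x.
Proof.
move=> gD.
have g0 x : g 0 x = 0.
  by apply: (addrI (g 0 x)); rewrite -gD !addr0.
have gB a b x : g (a - b) x = g a x - g b x.
  by apply: (addIr (g b x)); rewrite -gD !subrK.
split=> [D1 D2|c x].
  pose s := undup (dom D1 ++ dom D2).
  have us : uniq s by apply: undup_uniq.
  rewrite !(@fsum_widen G g _ s) //.
  - by rewrite -sumrB; apply: eq_bigr => x _; rewrite coeffB gB.
  - by move=> x xD; rewrite mem_undup mem_cat xD orbT.
  - by move=> x xD; rewrite mem_undup mem_cat xD.
  - by move=> x /domB; rewrite mem_undup.
rewrite (@fsum_widen G g _ [:: x]) //.
  by rewrite big_seq1 coeffU eqxx mulr1.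
move=> y; rewrite inE mem_dom coeffU; apply: contraR => /negPf.
by rewrite eq_sym => ->; rewrite mulr0.
Qed.

End FreeModule.

Section Exterior.
Variables (R : comNzRingType) (V : lmodType R) (k : nat).

Inductive extpow_rel : {freeg {ffun 'I_k -> V} / R} -> Prop :=
| ExtLinear t i a x y :
    extpow_rel (<< upd t i (a *: x + y) >> - a *: << upd t i x >>
             - << upd t i y >>)
| ExtAlternating (t : {ffun 'I_k -> V}) i j : i != j -> t i = t j -> extpow_rel << t >>.

Definition extpow : lmodType R := quotmod extpow_rel.

Definition wedge (t : {ffun 'I_k -> V}) : extpow := qcls extpow_rel << t >>.

Lemma wedge_lin t i a x y :
  wedge (upd t i (a *: x + y)) = a *: wedge (upd t i x) + wedge (upd t i y).
Proof.
apply/eqP; rewrite /wedge -subr_eq0 opprD addrA -qclsZ -!qclsB.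
by rewrite qcls0 //; exact: ExtLinear.
Qed.

Lemma wedge_alt (t : {ffun 'I_k -> V}) i j : i != j -> t i = t j -> wedge t = 0.
Proof. by move=> ij tij; rewrite /wedge qcls0 //; exact: ExtAlternating tij. Qed.

Lemma extpow_lift (G : zmodType) (f : R -> {ffun 'I_k -> V} -> G) :
  (forall a b t, f (a + b) t = f a t + f b t) ->
  (forall c t i a x y, f c (upd t i (a *: x + y)) =
     f (c * a) (upd t i x) + f c (upd t i y)) ->
  (forall c (t : {ffun 'I_k -> V}) i j, i != j -> t i = t j -> f c t = 0) ->
  exists h : {additive extpow -> G}, forall c t, h (c *: wedge t) = f c t.
Proof.
move=> fD flin falt; have [gB gE] := fsumP fD.
pose gM := GRing.isZmodMorphism.Build _ _ (fsum f) gB.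
pose g : {additive _ -> G} := HB.pack (fsum f) gM.
have [|h hE] := quotmod_lift (S := extpow_rel) (g := g).
  move=> c _ [t i a x y|t i j ij tij].
    rewrite !scalerBr scalerA !freegZ !mulr1 !raddfB /= !gE flin.
    by rewrite addrAC addrK subrr.
  by rewrite freegZ mulr1 /= gE; apply: falt tij.
exists h => c t; rewrite -qclsZ hE freegZ mulr1; exact: gE.
Qed.

Lemma extpow_ind (P : extpow -> Prop) :
  (forall x y, P x -> P y -> P (x + y)) ->
  (forall c t, P (c *: wedge t)) -> P 0 -> forall x, P x.
Proof.
move=> PD PW P0 x; rewrite -[x]qclsK -[repr x]freeg_sumE raddf_sum /=.
apply: big_ind => // t _; rewrite -[coeff _ _]mulr1 -freegZ qclsZ.
exact: PW.
Qed.

End Exterior.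

Section WedgeTheory.
Variables (R : comNzRingType) (V : lmodType R) (k : nat).
Implicit Types (t : {ffun 'I_k -> V}).

Lemma wedgeD t i x y :
  wedge (upd t i (x + y)) = wedge (upd t i x) + wedge (upd t i y).
Proof. by rewrite -[x in LHS]scale1r wedge_lin scale1r. Qed.

Lemma wedge0 t i : wedge (upd t i 0) = 0.
Proof.
by apply: (addrI (wedge (upd t i 0))); rewrite -wedgeD !addr0.
Qed.

Lemma wedgeZ t i a x : wedge (upd t i (a *: x)) = a *: wedge (upd t i x).
Proof. by rewrite -[a *: x]addr0 wedge_lin wedge0 addr0. Qed.

Lemma upd_id T (t : {ffun 'I_k -> T}) i : upd t i (t i) = t.
Proof. by apply/ffunP => j; rewrite ffunE; case: eqP => [->|]. Qed.

Lemma updE T (t : {ffun 'I_k -> T}) i x : upd t i x i = x.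
Proof. by rewrite ffunE eqxx. Qed.

Lemma updN T (t : {ffun 'I_k -> T}) i j x : j != i -> upd t i x j = t j.
Proof. by rewrite ffunE => /negPf->. Qed.

Lemma updC T (t : {ffun 'I_k -> T}) i j x y : i != j ->
  upd (upd t i x) j y = upd (upd t j y) i x.
Proof.
move=> ij; apply/ffunP => l; rewrite !ffunE.
by case: (l =P j) => // ->; rewrite eq_sym (negPf ij).
Qed.

Lemma wedge_swap t i j x y : i != j ->
  wedge (upd (upd t i x) j y) + wedge (upd (upd t i y) j x) = 0.
Proof.
move=> ij.
have alt z : wedge (upd (upd t i z) j z) = 0.
  by apply: (wedge_alt ij); rewrite updE updN // updE.
have := alt (x + y); rewrite wedgeD (updC _ _ _ ij) wedgeD.
rewrite [in X in _ + X](updC _ _ _ ij) wedgeD -!(updC _ _ _ ij) !alt.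
by rewrite add0r addr0 addrC.
Qed.

End WedgeTheory.

Section Kahler.
Variable F : fieldType.

Inductive kahler_rel : {freeg F / F} -> Prop :=
| KahlerAdd a b : kahler_rel (<< a + b >> - << a >> - << b >>)
| KahlerMul a b : kahler_rel (<< a * b >> - a *: << b >> - b *: << a >>).

Definition Omega1 : lmodType F := quotmod kahler_rel.

Definition kdiff (a : F) : Omega1 := qcls kahler_rel << a >>.

Lemma kdiffD a b : kdiff (a + b) = kdiff a + kdiff b.
Proof.
apply/eqP; rewrite /kdiff -subr_eq0 opprD addrA -!qclsB.
by rewrite qcls0 //; exact: KahlerAdd.
Qed.

Lemma kdiffM a b : kdiff (a * b) = a *: kdiff b + b *: kdiff a.
Proof.
apply/eqP; rewrite /kdiff -subr_eq0 opprD addrA -!qclsZ -!qclsB.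
by rewrite qcls0 //; exact: KahlerMul.
Qed.

Lemma Omega1_ind (P : Omega1 -> Prop) :
  (forall x y, P x -> P y -> P (x + y)) ->
  (forall c a, P (c *: kdiff a)) -> forall x, P x.
Proof.
move=> PD PW x; rewrite -[x]qclsK -[repr x]freeg_sumE raddf_sum /=.
apply: big_ind => // [|a _]; first by rewrite -(scale0r (kdiff 0)).
rewrite -[coeff _ _]mulr1 -freegZ qclsZ; exact: PW.
Qed.

(* Omega 0, the exterior power with exponent 0, is free of rank one on the
   empty wedge; see Omega0_basis. *)
Definition Omega (k : nat) : lmodType F := extpow Omega1 k.

(* dwedge b is kdiff (b 0) /\ ... /\ kdiff (b (k-1)). *)
Definition dwedge (k : nat) (b : {ffun 'I_k -> F}) : Omega k :=
  wedge [ffun i => kdiff (b i)].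

(* Omega_lift below: an additive map on Omega k is determined by, and can be
   prescribed on, the forms a *: dwedge b, subject to additivity in a and in
   each b i, the Leibniz rule in each b i, and alternation. *)
Section Lift1.
Variable G : zmodType.
Implicit Types (g : F -> F -> G).

Definition lift1 g (w : Omega1) : G := fsum g (repr w).

Definition good1 g :=
  [/\ forall a b x, g (a + b) x = g a x + g b x,
      forall c a b, g c (a + b) = g c a + g c b &
      forall c a b, g c (a * b) = g (c * a) b + g (c * b) a].

Lemma lift1P g : good1 g ->
  {morph lift1 g : x y / x + y} /\ forall c a, lift1 g (c *: kdiff a) = g c a.
Proof.
move=> [gD gA gM]; have [gB gE] := fsumP gD.
pose fM := GRing.isZmodMorphism.Build _ _ (fsum g) gB.
pose f : {additive _ -> G} := HB.pack (fsum g) fM.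
have [|h hE] := quotmod_lift (S := kahler_rel) (g := f).
  move=> c _ [a b|a b]; rewrite !scalerBr ?scalerA !freegZ !mulr1.
    by rewrite !raddfB /= !gE gA addrAC addrK subrr.
  by rewrite !raddfB /= !gE gM addrAC addrK subrr.
have lE x : lift1 g x = h x by rewrite -[x in RHS]qclsK hE.
split=> [x y|c a]; first by rewrite !lE raddfD.
by rewrite lE -qclsZ hE freegZ mulr1; exact: gE.
Qed.

Lemma lift1_ext g1 g2 w : g1 =2 g2 -> lift1 g1 w = lift1 g2 w.
Proof. by move=> g12; apply: eq_bigr => x _; rewrite g12. Qed.

Lemma lift1_add g1 g2 w :
  lift1 (fun c a => g1 c a + g2 c a) w = lift1 g1 w + lift1 g2 w.
Proof. exact: big_split. Qed.

Lemma lift1_scale g a w : good1 g ->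
  lift1 g (a *: w) = lift1 (fun c => g (a * c)) w.
Proof.
move=> gg; have [gD gE] := lift1P gg.
have [|hD hE] := @lift1P (fun c => g (a * c)).
  case: gg => g1 g2 g3; split=> *; first by rewrite mulrDr g1.
    exact: g2.
  by rewrite g3 !mulrA.
elim/Omega1_ind: w => [x y xP yP|c b]; first by rewrite scalerDr gD hD xP yP.
by rewrite scalerA gE hE.
Qed.

End Lift1.

Section LiftList.
Variable G : zmodType.
Implicit Types (f : F -> seq F -> G) (u v s : seq F) (ws : seq Omega1).

Fixpoint liftl f ws (c : F) : G :=
  if ws is w :: ws' then
    lift1 (fun e a => liftl (fun c s => f c (a :: s)) ws' (c * e)) w
  else f c [::].

Definition good f :=
  [/\ forall a b s, f (a + b) s = f a s + f b s,
      forall c u v a b,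
        f c (u ++ (a + b) :: v) = f c (u ++ a :: v) + f c (u ++ b :: v) &
      forall c u v a b,
        f c (u ++ (a * b) :: v) =
        f (c * a) (u ++ b :: v) + f (c * b) (u ++ a :: v)].

Definition altl f := forall c u a v z, f c (u ++ a :: v ++ a :: z) = 0.

Lemma good_cons f a : good f -> good (fun c s => f c (a :: s)).
Proof.
by case=> f1 f2 f3; split=> *; [exact: f1|exact: (f2 _ (a :: _))|
  exact: (f3 _ (a :: _))].
Qed.

Lemma altl_cons f a : altl f -> altl (fun c s => f c (a :: s)).
Proof. by move=> fa c u; apply: (fa c (a :: u)). Qed.

Lemma liftl_ext f g ws c : f =2 g -> liftl f ws c = liftl g ws c.
Proof.
elim: ws f g c => [|w ws IH] f g c fg /=; first exact: fg.
by apply: lift1_ext => e a; apply: IH => c' s.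
Qed.

Lemma liftl_add f g ws c :
  liftl (fun c s => f c s + g c s) ws c = liftl f ws c + liftl g ws c.
Proof.
elim: ws f g c => [|w ws IH] f g c //=; rewrite -lift1_add.
by apply: lift1_ext => e a; rewrite IH.
Qed.

Lemma liftl_addc f ws a b : (forall a b s, f (a + b) s = f a s + f b s) ->
  liftl f ws (a + b) = liftl f ws a + liftl f ws b.
Proof.
elim: ws f a b => [|w ws IH] f a b fD //=; rewrite -lift1_add.
by apply: lift1_ext => e x; rewrite mulrDl IH.
Qed.

Lemma liftl_slide f ws a c :
  liftl (fun c => f (c * a)) ws c = liftl f ws (c * a).
Proof.
elim: ws f c => [|w ws IH] f c //=.
apply: lift1_ext => e x; rewrite (IH (fun c s => f c (x :: s))).
by rewrite mulrAC.
Qed.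

Lemma liftl0 f ws c : (forall c s, f c s = 0) -> liftl f ws c = 0.
Proof.
elim: ws f c => [|w ws IH] f c f0 //=.
by apply: big1 => x _; apply: IH.
Qed.

Lemma good_liftl f ws c : good f ->
  good1 (fun e a => liftl (fun c s => f c (a :: s)) ws (c * e)).
Proof.
move=> gf; have [f1 f2 f3] := gf; split=> [a b x|e a b|e a b].
- by rewrite mulrDr liftl_addc //; case: (good_cons x gf).
- by rewrite -liftl_add; apply: liftl_ext => c' s; apply: (f2 _ [::]).
- rewrite !mulrA -(liftl_slide (fun c s => f c (b :: s))).
  rewrite -(liftl_slide (fun c s => f c (a :: s))) -liftl_add.
  by apply: liftl_ext => c' s; apply: (f3 _ [::]).
Qed.

Lemma liftl_lin f (u v : seq Omega1) a x y c : good f ->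
  liftl f (u ++ (a *: x + y) :: v) c =
  liftl f (u ++ x :: v) (c * a) + liftl f (u ++ y :: v) c.
Proof.
elim: u f c => [|w u IH] f c gf /=; last first.
  rewrite -lift1_add; apply: lift1_ext => e z.
  by rewrite IH; [rewrite mulrAC|exact: good_cons].
have gg := good_liftl v c gf.
have [-> _] := lift1P gg; rewrite lift1_scale //; congr (_ + _).
by apply: lift1_ext => e z; rewrite mulrA.
Qed.

Lemma liftl_D f (v : seq Omega1) a c : good f ->
  liftl f (kdiff a :: v) c = liftl (fun c s => f c (a :: s)) v c.
Proof.
move=> gf /=; rewrite -[kdiff a]scale1r.
by have [_ ->] := lift1P (good_liftl v c gf); rewrite mulr1.
Qed.

Lemma liftl_map f s c : good f -> liftl f (map kdiff s) c = f c s.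
Proof.
elim: s f => [|a s IH] f gf //; rewrite map_cons liftl_D // IH //.
exact: good_cons.
Qed.

Lemma liftl_insert f (v z : seq Omega1) b c : good f ->
  liftl f (v ++ kdiff b :: z) c =
  liftl (fun c s => f c (take (size v) s ++ b :: drop (size v) s)) (v ++ z) c.
Proof.
elim: v f c => [|w v IH] f c gf.
  rewrite liftl_D //; apply: liftl_ext => c' s.
  by rewrite take0 drop0.
apply: lift1_ext => e a.
exact: (IH (fun c s => f c (a :: s)) _ (good_cons a gf)).
Qed.

Lemma altl_swap f u a v b z c : good f -> altl f ->
  f c (u ++ a :: v ++ b :: z) + f c (u ++ b :: v ++ a :: z) = 0.
Proof.
move=> [_ fA _] fa; have := fa c u (a + b) v z.
rewrite fA.
have e x : f c (u ++ x :: v ++ (a + b) :: z) =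
    f c (u ++ x :: v ++ a :: z) + f c (u ++ x :: v ++ b :: z).
  have := fA c (u ++ x :: v) z a b.
  by rewrite -!catA.
by rewrite !e !fa add0r addr0.
Qed.

Lemma liftl_alt f (u v z : seq Omega1) (w : Omega1) c : good f -> altl f ->
  liftl f (u ++ w :: v ++ w :: z) c = 0.
Proof.
elim: u f c => [|w' u IH] f c gf fa /=; last first.
  by apply: big1 => x _; apply: IH; [exact: good_cons|exact: altl_cons].
rewrite -[LHS]/(liftl f (w :: v ++ w :: z) c).
pose B x y c := liftl f (x :: v ++ y :: z) c.
have Bl a x x' y e : B (a *: x + x') y e = B x y (e * a) + B x' y e.
  exact: (liftl_lin [::]).
have Br a x y y' e : B x (a *: y + y') e = B x y (e * a) + B x y' e.
  exact: (liftl_lin (x :: v)).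
have BlD x x' y e : B (x + x') y e = B x y e + B x' y e.
  by rewrite -[x]scale1r Bl mulr1 scale1r.
have BrD x y y' e : B x (y + y') e = B x y e + B x y' e.
  by rewrite -[y]scale1r Br mulr1 scale1r.
have B0l y e : B 0 y e = 0.
  by apply: (addrI (B 0 y e)); rewrite -BlD !addr0.
have B0r x e : B x 0 e = 0.
  by apply: (addrI (B x 0 e)); rewrite -BrD !addr0.
have BlZ a x y e : B (a *: x) y e = B x y (e * a).
  by rewrite -[a *: x]addr0 Bl B0l addr0.
have BrZ a x y e : B x (a *: y) e = B x y (e * a).
  by rewrite -[a *: y]addr0 Br B0r addr0.
have BDD a b e : B (kdiff a) (kdiff b) e + B (kdiff b) (kdiff a) e = 0.
  rewrite /B !liftl_D // !liftl_insert; try exact: good_cons.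
  rewrite -liftl_add; apply: liftl0 => c' s.
  exact: (altl_swap [::]).
have Bsym x y e : B x y e + B y x e = 0.
  elim/Omega1_ind: x => [x x' Hx Hx'|a p].
    by rewrite BlD BrD addrACA Hx Hx' addr0.
  elim/Omega1_ind: y => [y y' Hy Hy'|b q].
    by rewrite BrD BlD addrACA Hy Hy' addr0.
  by rewrite !BlZ !BrZ [e * b * a]mulrAC BDD.
rewrite -/(B w w c); elim/Omega1_ind: w => [x y Hx Hy|a p].
  by rewrite BlD !BrD Hx Hy add0r addr0 Bsym.
rewrite BlZ BrZ /B liftl_D // liftl_insert; last exact: good_cons.
by apply: liftl0 => c' s; apply: (fa _ [::]).
Qed.

End LiftList.

Section OmegaLift.
Variables (k : nat) (G : zmodType) (f : F -> {ffun 'I_k -> F} -> G).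
Hypothesis fD : forall a b t, f (a + b) t = f a t + f b t.
Hypothesis fA : forall c t i a b,
  f c (upd t i (a + b)) = f c (upd t i a) + f c (upd t i b).
Hypothesis fM : forall c t i a b,
  f c (upd t i (a * b)) = f (c * a) (upd t i b) + f (c * b) (upd t i a).
Hypothesis f_alt : forall c (t : {ffun 'I_k -> F}) i j, i != j -> t i = t j -> f c t = 0.

Let fs (c : F) (s : seq F) : G :=
  if size s == k then f c [ffun i : 'I_k => s`_i] else 0.

Let ffun_cat (T : Type) (x0 : T) (u v : seq T) a b (lt : (size u < k)%N) :
  [ffun i : 'I_k => nth x0 (u ++ a :: v) i] =
  upd [ffun i : 'I_k => nth x0 (u ++ b :: v) i] (Ordinal lt) a.
Proof.
apply/ffunP => i; rewrite !ffunE !nth_cat -val_eqE /=.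
case: ltngtP => // [h|->]; last by rewrite subnn.
by rewrite -(subnK h) addnS -addSn addnK.
Qed.

Let size_k (u v : seq F) a : size (u ++ a :: v) = k -> (size u < k)%N.
Proof. by move=> <-; rewrite size_cat /= addnS ltnS leq_addr. Qed.

Let fs_good : good fs.
Proof.
split=> [a b s|c u v a b|c u v a b]; rewrite /fs.
- by case: ifP => // _; rewrite addr0.
- rewrite !size_cat /=; case: eqP => [e|]; last by rewrite addr0.
  have lt : (size u < k)%N by apply: (@size_k _ v 0); rewrite size_cat.
  have E := fun x => @ffun_cat _ 0 u v x 0 lt.
  by rewrite (E (a + b)) fA -!E.
- rewrite !size_cat /=; case: eqP => [e|]; last by rewrite addr0.
  have lt : (size u < k)%N by apply: (@size_k _ v 0); rewrite size_cat.
  have E := fun x => @ffun_cat _ 0 u v x 0 lt.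
  by rewrite (E (a * b)) fM -!E.
Qed.

Let fs_alt : altl fs.
Proof.
move=> c u a v z; rewrite /fs; case: eqP => // e.
have lt1 : (size u < k)%N by apply: size_k e.
have lt2 : (size (u ++ a :: v) < k)%N.
  by apply: (@size_k _ z a); rewrite -catA.
apply: (@f_alt _ _ (Ordinal lt1) (Ordinal lt2)).
  by rewrite -val_eqE /= size_cat /= neq_ltn addnS ltnS leq_addr.
rewrite !ffunE /= nth_cat ltnn subnn /=.
by rewrite -cat_cons catA nth_cat ltnn subnn.
Qed.

Lemma Omega_lift : exists h : {additive Omega k -> G},
  forall c t, h (c *: dwedge t) = f c t.
Proof.
pose g c (t : {ffun 'I_k -> Omega1}) :=
  liftl fs [seq t i | i <- enum 'I_k] c.
have split_enum (t : {ffun 'I_k -> Omega1}) (i : 'I_k) x :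
    [seq upd t i x j | j <- enum 'I_k] =
    take i [seq t j | j <- enum 'I_k] ++
    x :: drop i.+1 [seq t j | j <- enum 'I_k].
  have sz : size [seq t j | j <- enum 'I_k] = k by rewrite size_map size_enum_ord.
  apply: (@eq_from_nth _ 0).
    rewrite size_cat /= size_take size_drop sz size_map size_enum_ord ltn_ord.
    by rewrite subnS addnS -addSn addSnnS prednK ?subn_gt0 // subnKC // ltnW.
  move=> j; rewrite size_map size_enum_ord => jk.
  rewrite (nth_map i) ?size_enum_ord // nth_cat size_take sz ltn_ord.
  rewrite ffunE -val_eqE /= nth_enum_ord //.
  case: ltngtP => // [h|h|->]; last by rewrite subnn.
    by rewrite nth_take // (nth_map i) ?size_enum_ord.
  have e : (j - i)%N = (j - i.+1).+1 by rewrite -subSn.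
  by rewrite e /= nth_drop subnKC // (nth_map i) ?size_enum_ord.
have [|||h hE] := @extpow_lift _ Omega1 k G g.
- by move=> a b t; apply: liftl_addc; case: fs_good.
- by move=> c t i a x y; rewrite /g !split_enum liftl_lin.
- move=> c t i j ij tij; rewrite /g.
  wlog lt_ij : i j ij tij / (i < j)%N.
    move=> W; case: (ltngtP i j) => [lt|lt|e]; first exact: W lt.
      by apply: (W j i) lt => //; rewrite eq_sym.
    by case/eqP: ij; apply: val_inj.
  set s := map _ _.
  have sz : size s = k by rewrite size_map size_enum_ord.
  have ns (l : 'I_k) : nth (0 : Omega1) s l = t l.
    by rewrite (nth_map l) ?size_enum_ord // nth_ord_enum.
  rewrite -(cat_take_drop i s) (drop_nth (0 : Omega1)) ?sz // ns.
  have -> : drop i.+1 s = take (j - i.+1) (drop i.+1 s) ++ t j :: drop j.+1 s.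
    rewrite -[LHS](cat_take_drop (j - i.+1)) drop_drop subnK //.
    by rewrite [drop j s](drop_nth (0 : Omega1)) ?sz // ns.
  by rewrite tij; apply: liftl_alt.
exists h => c t; rewrite hE /g.
have -> : [seq [ffun i => kdiff (t i)] i | i <- enum 'I_k] =
          map kdiff [seq t i | i <- enum 'I_k].
  by rewrite -map_comp; apply: eq_map => i; rewrite ffunE.
rewrite liftl_map // /fs size_map size_enum_ord eqxx; congr f.
apply/ffunP => i; rewrite ffunE (nth_map i) ?size_enum_ord //.
by rewrite nth_ord_enum.
Qed.

End OmegaLift.

Lemma Omega0_basis (t : {ffun 'I_0 -> F}) (w : Omega 0) :
  exists! a, w = a *: dwedge t.
Proof.
have [|c s []//|c s []//|c s []//|h hE] :=
  @Omega_lift 0 F (fun c _ => c); first by [].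
have wt (u s : {ffun 'I_0 -> Omega1}) : u = s by apply/ffunP => -[].
have wE : exists a, w = a *: dwedge t.
  elim/extpow_ind: w => [x y [a ->] [b ->]|c s|].
  - by exists (a + b); rewrite scalerDl.
  - by exists c; congr (_ *: wedge _); apply: wt.
  - by exists 0; rewrite scale0r.
case: wE => a ->; exists a; split=> // b /(congr1 h).
by rewrite !hE.
Qed.

Section DwedgeTheory.
Variable k : nat.
Implicit Types (t : {ffun 'I_k -> F}) (i : 'I_k).

Lemma dwedge_upd t i x :
  dwedge (upd t i x) = wedge (upd [ffun j => kdiff (t j)] i (kdiff x)).
Proof.
congr wedge; apply/ffunP => j; rewrite !ffunE.
by case: (j == i).
Qed.

Lemma dwedgeD t i x y :
  dwedge (upd t i (x + y)) = dwedge (upd t i x) + dwedge (upd t i y).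
Proof. by rewrite !dwedge_upd kdiffD wedgeD. Qed.

Lemma dwedgeM t i x y :
  dwedge (upd t i (x * y)) =
  x *: dwedge (upd t i y) + y *: dwedge (upd t i x).
Proof. by rewrite !dwedge_upd kdiffM wedgeD !wedgeZ. Qed.

Lemma dwedge_alt t i j : i != j -> t i = t j -> dwedge t = 0.
Proof. by move=> ij tij; apply: (wedge_alt ij); rewrite !ffunE tij. Qed.

Lemma dwedge_swap t i j x y : i != j ->
  dwedge (upd (upd t i x) j y) + dwedge (upd (upd t i y) j x) = 0.
Proof.
move=> ij; have E p q : dwedge (upd (upd t i p) j q) =
    wedge (upd (upd [ffun l => kdiff (t l)] i (kdiff p)) j (kdiff q)).
  rewrite dwedge_upd; congr (wedge (upd _ _ _)).
  by apply/ffunP => l; rewrite !ffunE; case: (l == i).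
by rewrite !E wedge_swap.
Qed.

Lemma Omega_gen (P : Omega k -> Prop) :
  P 0 -> (forall x y, P x -> P y -> P (x + y)) ->
  (forall c b, P (c *: dwedge b)) -> forall x, P x.
Proof.
move=> P0 PD PW; suff W (s : seq 'I_k) (t : {ffun 'I_k -> Omega1}) :
    (forall i, i \notin s -> exists b, t i = kdiff b) -> forall c, P (c *: wedge t).
  by elim/extpow_ind => // c t; apply: (W (enum 'I_k)) => i; rewrite mem_enum.
elim: s t => [|i s IH] t Ht c.
  have /choice[b bE] i : exists b, t i = kdiff b by apply: Ht.
  suff -> : wedge t = dwedge (finfun b) by [].
  by congr wedge; apply/ffunP => i; rewrite !ffunE.
rewrite -[t](upd_id _ i); elim/Omega1_ind: (t i) c => [x y Px Py c|e a c].
  by rewrite wedgeD scalerDr; apply: PD.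
rewrite wedgeZ scalerA; apply: IH => j js; rewrite ffunE.
case: eqP => [_|/eqP ji]; first by exists a.
by apply: Ht; rewrite inE negb_or ji.
Qed.

End DwedgeTheory.

Lemma fcons_upd k (T : Type) x (t : {ffun 'I_k -> T}) i y :
  fcons x (upd t i y) = upd (fcons x t) (fintype.lift ord0 i) y.
Proof.
apply/ffunP => j; rewrite !ffunE; case: unliftP => [l ->|->] /=.
  by rewrite ffunE (inj_eq (@lift_inj _ _)).
by [].
Qed.

Lemma fcons0 k (T : Type) x y (t : {ffun 'I_k -> T}) :
  fcons x t = upd (fcons y t) ord0 x.
Proof.
apply/ffunP => j; rewrite !ffunE; case: unliftP => [l ->|->] //=.
Qed.

Lemma fcons_behead k (T : Type) (t : {ffun 'I_k.+1 -> T}) :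
  fcons (t ord0) [ffun i => t (fintype.lift ord0 i)] = t.
Proof.
by apply/ffunP => j; rewrite !ffunE; case: unliftP => [l ->|->] //=; rewrite ffunE.
Qed.

Lemma ediff_exists k : exists h : {additive Omega k -> Omega k.+1},
  forall a b, h (a *: dwedge b) = dwedge (fcons a b).
Proof.
apply: Omega_lift => [a b t|c t i a b|c t i a b|c t i j ij tij].
- have E x := fcons0 x 0 t.
  by rewrite (E (a + b)) dwedgeD -!E.
- by rewrite !fcons_upd dwedgeD.
- have l0 : ord0 != fintype.lift ord0 i by apply: neq_lift.
  have E x := fcons0 x 0 t.
  rewrite !fcons_upd dwedgeM (E c) (E (c * a)) (E (c * b)).
  rewrite !(updC _ (c * _) _ l0) !dwedgeM -!(updC _ _ _ l0).
  rewrite addrACA -scalerDr dwedge_swap // scaler0 add0r addrC.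
  by [].
- apply: (@dwedge_alt _ _ (fintype.lift ord0 i) (fintype.lift ord0 j)).
    by rewrite (inj_eq (@lift_inj _ _)).
  by rewrite !ffunE !liftK /= tij.
Qed.

Definition ediff k : {additive Omega k -> Omega k.+1} := sval (cid (ediff_exists k)).

Lemma ediffE k a (b : {ffun 'I_k -> F}) : ediff k (a *: dwedge b) = dwedge (fcons a b).
Proof. exact: (svalP (cid (ediff_exists k))). Qed.

Lemma ediff_unique k (h : {additive Omega k -> Omega k.+1}) :
  (forall a b, h (a *: dwedge b) = dwedge (fcons a b)) -> h =1 ediff k.
Proof.
move=> hE; elim/Omega_gen => [|x y hx hy|a b]; first by rewrite !raddf0.
  by rewrite !raddfD hx hy.
by rewrite hE ediffE.
Qed.

(* The image of ediff from degree k-1, with Omega^(-1) = 0. *)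
Definition exact_form k : Omega k -> bool :=
  match k with
  | 0 => fun w => w == 0
  | k'.+1 => fun w => `[< exists v, ediff k' v = w >]
  end.

Lemma exact_form_zmod k : zmod_closed (@exact_form k).
Proof.
case: k => [|k].
  by split=> [|x y]; rewrite -!topredE /= // => /eqP-> /eqP->; rewrite subrr.
split=> [|x y /asboolP[v <-] /asboolP[w <-]]; apply/asboolP.
  by exists 0; rewrite raddf0.
by exists (v - w); rewrite raddfB.
Qed.

HB.instance Definition _ k :=
  GRing.isZmodClosed.Build (Omega k) (@exact_form k) (@exact_form_zmod k).

Definition Omega_mod_exact k : zmodType :=
  Quotient.quot (GRing.ZmodClosed.clone (Omega k) (@exact_form k) _).

Definition mod_exact k (w : Omega k) : Omega_mod_exact k :=
  \pi_(Omega_mod_exact k) w.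

Lemma mod_exact_is_zmod k : zmod_morphism (@mod_exact k).
Proof. by move=> x y; rewrite /mod_exact raddfB. Qed.

HB.instance Definition _ k := GRing.isZmodMorphism.Build
  (Omega k) (Omega_mod_exact k) (@mod_exact k) (@mod_exact_is_zmod k).

Lemma mod_exact_eq k (v w : Omega k) :
  (mod_exact v == mod_exact w) = exact_form (v - w).
Proof. by rewrite /mod_exact -Quotient.idealrBE. Qed.

Lemma mod_exact_dwedge k (t : {ffun 'I_k.+1 -> F}) : mod_exact (dwedge t) = 0.
Proof.
rewrite -(raddf0 (@mod_exact k.+1)); apply/eqP; rewrite mod_exact_eq subr0.
apply/asboolP; exists (t ord0 *: dwedge [ffun i => t (fintype.lift ord0 i)]).
by rewrite ediffE fcons_behead.
Qed.

Definition dlog (b : F) : Omega1 := b^-1 *: kdiff b.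

(* a * d(b_0)/b_0 /\ ... /\ d(b_(k-1))/b_(k-1), meant for nonzero b_i. *)
Definition dlog_form k (a : F) (b : {ffun 'I_k -> F}) : Omega k :=
  a *: wedge [ffun i => dlog (b i)].

Lemma wedge_scale k (e : 'I_k -> F) (t : {ffun 'I_k -> Omega1}) :
  wedge [ffun i => e i *: t i] = (\prod_i e i) *: wedge t.
Proof.
suff W (s : seq 'I_k) : uniq s ->
    wedge [ffun i => if i \in s then e i *: t i else t i] =
    (\prod_(i <- s) e i) *: wedge t.
  rewrite -[in RHS](W _ (index_enum_uniq _)); congr wedge.
  by apply/ffunP => i; rewrite !ffunE mem_index_enum.
elim: s => [_|i s IH /= /andP[is_ us]].
  by rewrite big_nil scale1r; congr wedge; apply/ffunP => i; rewrite ffunE.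
rewrite big_cons -scalerA -IH //.
set u := [ffun j => if j \in s then _ else _].
have -> : u = upd u i (t i).
  by rewrite -[u in LHS](upd_id _ i) /u ffunE (negPf is_).
rewrite -wedgeZ; congr wedge; apply/ffunP => j; rewrite !ffunE inE.
by case: eqP => [->|].
Qed.

Lemma dlog_formE k a (b : {ffun 'I_k -> F}) :
  dlog_form a b = (a * \prod_i (b i)^-1) *: dwedge b.
Proof.
rewrite /dlog_form -scalerA -wedge_scale; congr (_ *: wedge _).
by apply/ffunP => i; rewrite !ffunE.
Qed.

Definition decomposable k (w : Omega k) : Prop :=
  exists (a : F) (b : {ffun 'I_k -> F}),
    (forall i, b i != 0) /\ w = dlog_form a b.

Lemma Omega_decomposable k (w : Omega k) :
  exists (r : nat) (e : 'I_r -> Omega k),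
    (forall i, decomposable (e i)) /\ w = \sum_i e i.
Proof.
elim/Omega_gen: w => [|x y [r [e [he ->]]] [s [g [hg ->]]]|c b].
- by exists 0, (fun=> 0); split=> [[]|] //; rewrite big_ord0.
- exists (r + s)%N, (fun i => match fintype.split i with
    inl j => e j | inr j => g j end).
  split=> [i|]; first by case: (fintype.split i).
  rewrite big_split_ord /=; congr (_ + _); apply: eq_bigr => i _.
    case: splitP => j /= ij; first by congr e; apply: val_inj.
    by have := ltn_ord i; rewrite ij ltnNge leq_addr.
  case: splitP => j /= ij; last by congr g; apply: val_inj; apply: addnI ij.
  by have := ltn_ord j; rewrite -ij ltnNge leq_addr.
- case: (pselect (forall i, b i != 0)) => [b0|/existsNP[i /negP]].
    exists 1%N, (fun=> c *: dwedge b); split=> [_|]; last by rewrite big_ord1.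
    exists (c * \prod_i b i), b; split=> //.
    rewrite dlog_formE -mulrA -big_split /= big1 ?mulr1 // => i _.
    exact: mulfV.
  rewrite negbK => /eqP bi0; exists 0, (fun=> 0); split=> [[]|] //.
  rewrite big_ord0 -(upd_id b i) bi0 dwedge_upd.
  suff -> : kdiff 0 = 0 by rewrite wedge0 scaler0.
  by apply: (addrI (kdiff 0)); rewrite -kdiffD !addr0.
Qed.

Section KatoMilne.
Hypothesis char2 : 2%N \in [pchar F].

Lemma sqrD (a b : F) : (a + b) ^+ 2 = a ^+ 2 + b ^+ 2.
Proof. by rewrite sqrrD mulr2n addrr_pchar2 // addr0. Qed.

Lemma dwedge_exact k (t : {ffun 'I_k -> F}) i c x :
  mod_exact ((c ^+ 2 * \prod_(j | j != i) t j) *: dwedge (upd t i x)) = 0.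
Proof.
case: k t i => [t []//|k t i]; set P := \prod_(_ | _) _.
have wP : dwedge (upd t i P) = 0.
  rewrite /P; elim/big_rec: _ => [|j y ji IH].
    have := dwedgeM t i 1 1.
    rewrite mulr1 scale1r => /eqP; rewrite -subr_eq0 opprD addrA subrr.
    by rewrite sub0r oppr_eq0 => /eqP.
  rewrite dwedgeM IH scaler0 add0r.
  rewrite (@dwedge_alt _ _ i j) ?scaler0 1?eq_sym //.
  by rewrite updE updN.
have wc : dwedge (upd t i (c ^+ 2)) = 0.
  rewrite expr2 dwedgeM -scalerDl addrr_pchar2 ?scale0r //.
have := dwedgeM t i (c ^+ 2 * P) x.
rewrite [dwedge (upd t i (c ^+ 2 * P))]dwedgeM wP wc !scaler0 addr0 scaler0.
by rewrite addr0 => <-; apply: mod_exact_dwedge.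
Qed.

(* Since a dlog b_0 /\ ... = (a / \prod b_i) db_0 /\ ..., the map
   a dlog b |-> (a^2 - a) dlog b reads c db |-> (c^2 \prod b_i - c) db, which
   also makes sense when some b_i is zero. *)
Lemma artin_schreier_exists k : exists h : {additive Omega k -> Omega_mod_exact k},
  forall c (t : {ffun 'I_k -> F}), h (c *: dwedge t) =
    mod_exact ((c ^+ 2 * \prod_i t i) *: dwedge t) - mod_exact (c *: dwedge t).
Proof.
have pU (t : {ffun 'I_k -> F}) i x :
    \prod_j upd t i x j = x * \prod_(j | j != i) t j.
  rewrite (bigD1 i) //= updE; congr (_ * _).
  by apply: eq_bigr => j; apply: updN.
apply: Omega_lift => [a b t|c t i a b|c t i a b|c t i j ij tij].
- by rewrite sqrD mulrDl !scalerDl !raddfD addrACA.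
- rewrite addrACA -opprD -!(raddfD (@mod_exact k)) -scalerDr -dwedgeD.
  congr (_ - _).
  rewrite !pU dwedgeD; set P := \prod_(_ | _) _.
  apply/eqP; rewrite -subr_eq0 -raddfB; apply/eqP.
  rewrite -[RHS](dwedge_exact t i c (a * b)) -/P; congr mod_exact.
  have -> : c ^+ 2 * ((a + b) * P) = c ^+ 2 * (a * P) + c ^+ 2 * (b * P).
    by rewrite mulrDl mulrDr.
  rewrite dwedgeM [RHS]scalerDr !scalerA -![c ^+ 2 * P * _]mulrA ![P * _]mulrC.
  move: (c ^+ 2 * (a * P)) (c ^+ 2 * (b * P)) => p q.
  have E (x y z w : Omega k) : x + y + (z + w) - (x + w) = y + z.
    by rewrite [z + w]addrC (addrACA x y w z) [x + w + _]addrC addrK.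
  by rewrite scalerDl !scalerDr E.
- rewrite addrACA -opprD -!(raddfD (@mod_exact k)); congr (mod_exact _ - mod_exact _).
    rewrite !pU dwedgeM scalerDr !scalerA; congr (_ *: _ + _ *: _).
      by rewrite !expr2; ring.
    by rewrite !expr2; ring.
  by rewrite dwedgeM scalerDr !scalerA.
- by rewrite (dwedge_alt ij tij) !scaler0 subrr.
Qed.

Definition artin_schreier k : {additive Omega k -> Omega_mod_exact k} :=
  sval (cid (artin_schreier_exists k)).

Lemma artin_schreierE k a (b : {ffun 'I_k -> F}) : (forall i, b i != 0) ->
  artin_schreier k (dlog_form a b) = mod_exact (dlog_form (a ^+ 2 - a) b).
Proof.
move=> b0; rewrite !dlog_formE /artin_schreier (svalP (cid (artin_schreier_exists k))) -raddfB /=.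
rewrite -scalerBl mulrBl; congr (mod_exact ((_ - _) *: _)).
rewrite exprMn -mulrA; congr (_ * _).
rewrite expr2 -mulrA -big_split /= [X in _ * X]big1 ?mulr1 // => i _.
exact: mulVf.
Qed.

Lemma artin_schreier_unique k (h : {additive Omega k -> Omega_mod_exact k}) :
  (forall a (b : {ffun 'I_k -> F}), (forall i, b i != 0) ->
     h (dlog_form a b) = mod_exact (dlog_form (a ^+ 2 - a) b)) ->
  h =1 artin_schreier k.
Proof.
move=> hE w; have [r [e [he ->]]] := Omega_decomposable w.
rewrite !raddf_sum; apply: eq_bigr => i _.
by have [a [b [b0 ->]]] := he i; rewrite hE // artin_schreierE.
Qed.

Definition as_image k (y : Omega_mod_exact k) : bool :=
  `[< exists w, artin_schreier k w = y >].

Lemma as_image_zmod k : zmod_closed (@as_image k).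
Proof.
split=> [|x y /asboolP[v <-] /asboolP[w <-]]; apply/asboolP.
  by exists 0; rewrite raddf0.
by exists (v - w); rewrite raddfB.
Qed.

HB.instance Definition _ k := GRing.isZmodClosed.Build
  (Omega_mod_exact k) (@as_image k) (@as_image_zmod k).

Definition coker_as k : zmodType :=
  Quotient.quot (GRing.ZmodClosed.clone (Omega_mod_exact k) (@as_image k) _).

(* The group H_2^n(F), for n >= 1; the value at n = 0 is junk. *)
Definition kato_milne (n : nat) : zmodType := coker_as n.-1.

Definition kato_milne_class n (w : Omega n.-1) : kato_milne n :=
  \pi_(kato_milne n) (mod_exact w).

Lemma kato_milne_class_is_zmod n : zmod_morphism (@kato_milne_class n).
Proof. by move=> x y; rewrite /kato_milne_class !raddfB. Qed.

HB.instance Definition _ n := GRing.isZmodMorphism.Build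
  (Omega n.-1) (kato_milne n) (@kato_milne_class n) (@kato_milne_class_is_zmod n).

Definition expressible n (x : kato_milne n) (r : nat) : Prop :=
  exists w : 'I_r -> Omega n.-1,
    (forall i, decomposable (w i)) /\ x = \sum_i kato_milne_class (w i).

Lemma kato_milne_generated n (x : kato_milne n) : exists r, `[< expressible x r >].
Proof.
have [w ->] : exists w, x = kato_milne_class w.
  exists (repr (repr x)); rewrite /kato_milne_class /mod_exact.
  by rewrite (reprK (repr x : Omega_mod_exact _)) reprK.
have [r [e [he ->]]] := Omega_decomposable w.
by exists r; apply/asboolP; exists e; split=> //; rewrite raddf_sum.
Qed.

Definition symbol_length n (x : kato_milne n) : nat :=
  ex_minn (kato_milne_generated x).

Definition sl2 (n : nat) : \bar nat :=
  nat_sup [set symbol_length x | x in [set: kato_milne n]].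

End KatoMilne.
End Kahler.

(* Main.v *)
From HB Require Import structures.
Require Import Defs.
From mathcomp Require Import all_boot all_order all_algebra.
From mathcomp Require Import zify ring.
From mathcomp.classical Require Import boolp.
From mathcomp.reals Require Import constructive_ereal.
Set Implicit Arguments.
Unset Strict Implicit.
Unset Printing Implicit Defensive.
Import GRing.Theory.
Local Open Scope ring_scope.

(** Write [[a, e]] for the binary quadratic form [a X^2 + X Y + e Y^2]. The symbol
    [alpha dlog y_1 /\ ... /\ dlog y_k] is attached to a quadratic Pfister form,
    which is a sum of forms [[a, e]] ([pfister]). If every anisotropic nonsingular
    form has dimension at most [U], then a sum of more than [U] forms [[a, e]] is
    isotropic and loses a plane in the Witt group, so that a sum of any number of
    Pfister forms is Witt equivalent to [[c_1, e_1] + ... + [c_U, e_U]]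
    ([witt_reduction]). When the [c_j] become squares this is [[1, f]] with
    [f = c_1 e_1 + ... + c_U e_U]. By Kato, the Witt class of a sum of Pfister
    forms determines the class in Kato-Milne cohomology; hence the class dies over
    the extension by the square roots of the [c_j] and equals the sum of the classes
    of [dlog c_j /\ eta_j] for some forms [eta_j] of degree one less
    ([bounded_slots]). By induction the class of [eta_j] has bounded symbol length,
    and so has the given class ([boundedS]).

    Most of the text proves the relative form of Kato's theorem that this uses
    ([nul_slotted]). Let [E] be the field of the elements whose differential lies in
    the span of the [dlog c_j]; it contains the squares and the [c_j]. The finitely
    many elements in play lie in a finite extension [K] of [E], which has a 2-basis
    [b_1, ..., b_m] and is graded by the subsets of the index set
    ([frame_exists]). The form [[a, e]] is the tensor [a (x) e] of [K (x)_E K], and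
    the relations of the Witt group are the alternating tensors ([tau_swap]) and the
    tensors [a (x) a e^2 - a (x) e] ([tau_frob]). Since [(b (x) 1 - 1 (x) b)^2 = 0]
    for every [b], the graded ring of [K (x)_E K] by the powers of the kernel of
    multiplication is the algebra of differential forms of [K] over [E]; a Pfister
    form with [k] slots lies in the [k]-th power, with its symbol as leading form
    ([leading_pf]). On leading forms, the difference of a tensor and its image
    under exchange of the factors is the exterior derivative ([alt_exact]), and [a (x) e |-> a (x) a e^2] induces
    [a dlog b |-> a^2 dlog b]. A relation therefore has zero leading form in
    Kato-Milne cohomology ([nul_leading]), provided that it does not come from
    tensors of lower degree. These are removed in [frob_low], because the kernel of
    the Artin-Schreier map consists of logarithmic forms: [alt_top] restricts the
    leading coefficient of an element of the kernel, and [log_leading] finds a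
    logarithmic form with this leading coefficient. *)

(** * Subsets and gradings *)

Section SymmetricDifference.
Variable T : finType.
Implicit Types A B C I J X Y : {set T}.

Definition symd A B : {set T} := [set i | (i \in A) (+) (i \in B)].

Lemma in_symd A B i : (i \in symd A B) = (i \in A) (+) (i \in B).
Proof. by rewrite inE. Qed.

Lemma symdC A B : symd A B = symd B A.
Proof. by apply/setP => i; rewrite !in_symd addbC. Qed.

Lemma symdK A : involutive (symd A).
Proof. by move=> B; apply/setP => i; rewrite !in_symd addKb. Qed.

Lemma symdKr A B : symd (symd B A) A = B.
Proof. by apply/setP => i; rewrite !in_symd addbK. Qed.

Lemma symd0 A : symd A set0 = A.
Proof. by apply/setP => i; rewrite in_symd inE addbF. Qed.

Lemma subset_symd A B I : (I \subset symd A B) = (I :\: B == I :&: A).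
Proof.
apply/subsetP/eqP => [sI|E i iI].
  apply/setP => i; rewrite !inE; case iI: (i \in I); rewrite ?andbF //=.
  by have := sI i iI; rewrite in_symd; case: (i \in A); case: (i \in B).
have /setP/(_ i) := E; rewrite !inE iI /= andbT.
by case: (i \in A); case: (i \in B).
Qed.

End SymmetricDifference.

Section Char2.
Variables (K : fieldType) (char2 : 2%N \in [pchar K]).

Lemma addKK (x : K) : x + x = 0.
Proof. exact: addrr_pchar2. Qed.

Lemma eq_addr0 (x y : K) : x + y = 0 -> x = y.
Proof. by move=> xy; rewrite -[x]addr0 -(addKK y) addrA xy add0r. Qed.

(** A nonempty interval of the lattice of subsets is a cube, with an even number of
    elements unless it is a point. *)
Lemma interval_parity (T : finType) (X Y : {set T}) :
  \sum_(J : {set T} | (Y \subset J) && (J \subset X)) (1 : K) = (Y == X)%:R.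
Proof.
case: eqP => [->|/eqP YX].
  by rewrite (big_pred1 X) // => J /=; rewrite [RHS]eq_sym eqEsubset.
case: (boolP (Y \subset X)) => [sYX|nYX]; last first.
  rewrite big1 // => J /andP[YJ JX]; case/negP: nYX; exact: subset_trans JX.
have /subsetPn[z zX zY] : ~~ (X \subset Y).
  by apply: contraNN YX => XY; rewrite eqEsubset sYX.
rewrite (bigID (fun J : {set T} => z \in J)) /=.
rewrite (reindex_inj (can_inj (symdK [set z]))) /=.
rewrite [X in _ + X](eq_bigl (fun J : {set T} => (Y \subset symd [set z] J) &&
   (symd [set z] J \subset X) && (z \in symd [set z] J))) ?addKK // => J.
rewrite in_symd set11 /=; case: (boolP (z \in J)) => zJ; rewrite ?andbF //= !andbT.
congr (_ && _); apply/subsetP/subsetP => sub i iI.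
- rewrite in_symd inE; case: eqP => [ei|_] /=; last exact: sub.
  by rewrite ei (negPf zJ).
- by have := sub i iI; rewrite in_symd inE; case: eqP => // ei; move: zY; rewrite -ei iI.
- by move: iI; rewrite in_symd inE; case: eqP => [->|_] //=; exact: sub.
- by case: (eqVneq i z) => [->//|iz]; apply: sub; rewrite in_symd inE (negPf iz).
Qed.

End Char2.

(** A field with a grading by the group of subsets of a finite type under
    symmetric difference. The model is an extension [K = E(b_1, ..., b_m)] of a field
    [E] containing the squares, where [gr A x] is the part of [x] that is an
    [E]-multiple of [\prod_(i in A) b_i]. *)
Record grading (K : fieldType) (T : finType) := Grading {
  gr :> {set T} -> K -> K;
  grD : forall A, {morph gr A : x y / x + y};
  gr_sum : forall x, \sum_A gr A x = x;
  gr_gr : forall A B x, gr A (gr B x) = if A == B then gr A x else 0;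
  grM : forall C x y, gr C (x * y) = \sum_A gr A x * gr (symd A C) y }.

Section Graded.
Variables (K : fieldType) (char2 : 2%N \in [pchar K]).
Variables (T : finType) (g : grading K T).
Implicit Types (A B C I J : {set T}) (x y e : K).

Lemma gr0 A : g A 0 = 0.
Proof. by apply: (addrI (g A 0)); rewrite -grD !addr0. Qed.

Lemma gr_sumr A (J : Type) (r : seq J) (P : pred J) (F : J -> K) :
  g A (\sum_(j <- r | P j) F j) = \sum_(j <- r | P j) g A (F j).
Proof. by apply: (big_morph (g A) (@grD _ _ g A) (gr0 A)). Qed.

Lemma sum_symd C (F : {set T} -> K) :
  (forall A, F (symd A C) = F A) -> C != set0 -> \sum_A F A = 0.
Proof.
move=> FC /set0Pn[c cC]; rewrite (bigID (fun A : {set T} => c \in A)) /=.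
rewrite (reindex_inj (inv_inj (symdK C))) /=.
rewrite (eq_big (fun A : {set T} => c \notin A) F) ?(addKK char2) // => A.
  by rewrite in_symd cC.
by rewrite symdC FC.
Qed.

(** The square of a sum of homogeneous elements has no cross terms. *)
Lemma gr_sqr A x : g A (x ^+ 2) = if A == set0 then x ^+ 2 else 0.
Proof.
suff N C : C != set0 -> g C (x ^+ 2) = 0.
  case: eqP => [->|/eqP/N //]; rewrite -[in RHS](gr_sum g (x ^+ 2)) (bigD1 set0) //=.
  by rewrite big1 ?addr0.
move=> C0; rewrite expr2 grM; apply: sum_symd (C0) => B.
by rewrite symdKr mulrC.
Qed.

Lemma gr1 A : g A 1 = (A == set0)%:R.
Proof. by rewrite -(expr1n K 2) gr_sqr; case: eqP; rewrite ?expr1n. Qed.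

Lemma gr0M C x y : g set0 x = x -> g C (x * y) = x * g C y.
Proof.
move=> x0; rewrite grM (bigD1 set0) //= x0 symdC symd0 big1 ?addr0 // => A A0.
by rewrite -x0 gr_gr (negPf A0) mul0r.
Qed.

(** The iterated derivation along the directions in [I], which
    multiplies the [i]-th generator by 1 for [I = [set i]]. *)
Definition pderiv I x := \sum_(A : {set T} | I \subset A) g A x.
Local Notation D := pderiv.

Lemma D0 x : D set0 x = x.
Proof. by rewrite -[RHS](gr_sum g); apply: eq_bigl => A; rewrite sub0set. Qed.

Lemma D1 I : D I 1 = (I == set0)%:R.
Proof.
rewrite /pderiv; case: eqP => [->|/eqP I0].
  rewrite (bigD1 set0) ?sub0set //= gr1 eqxx big1 ?addr0 // => A /andP[_ A0].
  by rewrite gr1 (negPf A0).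
rewrite big1 // => A IA; rewrite gr1; case: eqP => // A0.
by move: IA; rewrite A0 subset0 (negPf I0).
Qed.

Lemma sum_interval (X Y : {set T}) z :
  \sum_(J : {set T} | (Y \subset J) && (J \subset X)) z = (Y == X)%:R * z :> K.
Proof.
by rewrite -(interval_parity char2) mulr_suml; apply: eq_bigr => J _; rewrite mul1r.
Qed.

(** The cross terms of the Leibniz rule for an iterated derivation occur an
    even number of times, so that only the disjoint decompositions remain. *)
Lemma DM I x y :
  D I (x * y) = \sum_(J : {set T} | J \subset I) D J x * D (I :\: J) y.
Proof.
transitivity (\sum_A \sum_B (I :\: B == I :&: A)%:R * (g A x * g B y)).
  rewrite /pderiv; under eq_bigr do rewrite grM.
  rewrite exchange_big /=; apply: eq_bigr => A _.
  rewrite (reindex_inj (inv_inj (symdK A))) /= big_mkcond /=.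
  apply: eq_bigr => B _; rewrite symdK subset_symd.
  by case: ifP; rewrite ?mul1r ?mul0r.
transitivity (\sum_A \sum_B \sum_(J : {set T} | (I :\: B \subset J) && (J \subset I :&: A))
   (g A x * g B y)).
  by apply: eq_bigr => A _; apply: eq_bigr => B _; rewrite sum_interval.
under eq_bigr => A _ do (under eq_bigr => B _ do rewrite big_mkcond; rewrite exchange_big).
rewrite exchange_big /= [RHS]big_mkcond; apply: eq_bigr => J _.
case: ifP => JI; last first.
  by rewrite big1 // => A _; rewrite big1 // => B _; rewrite subsetI JI andbF.
rewrite /pderiv big_distrl /= [RHS]big_mkcond; apply: eq_bigr => A _.
case: ifP => JA; last first.
  by rewrite big1 // => B _; rewrite subsetI JA !andbF.
rewrite big_distrr /= [RHS]big_mkcond; apply: eq_bigr => B _.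
by rewrite subsetI JI JA !andbT !subDset setUC.
Qed.

End Graded.

(** * Alternating tensors *)

Section Weight.
Variable m : nat.
Implicit Types I J : {set 'I_m}.

(** A set read as a binary number; this orders the sets lexicographically, largest
    elements first, and bounds the descending induction on leading terms. *)
Definition wt I : nat := \sum_(i in I) 2 ^ i.

Lemma wtD1 I (i : 'I_m) : i \in I -> wt I = (2 ^ i + wt (I :\ i))%N.
Proof. exact: big_setD1. Qed.

Lemma wt_lt I (c : nat) : (forall i : 'I_m, i \in I -> (i < c)%N) -> (wt I < 2 ^ c)%N.
Proof.
elim: c I => [|c IH] I Ic.
  by rewrite /wt big1 // => i /Ic.
case: (pickP (fun i : 'I_m => (i \in I) && (i == c :> nat))) => [i /andP[iI /eqP ic]|no].
  rewrite (wtD1 iI) ic expnS mul2n -addnn ltn_add2l; apply: IH => j.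
  rewrite in_setD1 => /andP[ji /Ic]; rewrite ltnS leq_eqVlt => /orP[/eqP jc|//].
  by case/eqP: ji; apply: val_inj; rewrite /= jc ic.
apply: (leq_trans (IH I _)) => [i iI|]; last by rewrite leq_exp2l.
have := Ic i iI; rewrite ltnS leq_eqVlt => /orP[ic|//].
by have := no i; rewrite iI ic.
Qed.

Lemma wt_inj : injective wt.
Proof.
suff W (n : nat) I J : (forall i : 'I_m, i \in I -> (i < n)%N) ->
    (forall i : 'I_m, i \in J -> (i < n)%N) -> wt I = wt J -> I = J.
  by move=> I J; apply: (W m).
elim: n I J => [|n IH] I J In Jn E.
  by apply/setP => i; apply/idP/idP => [/In|/Jn].
have low (A : {set 'I_m}) (i : 'I_m) : (forall i : 'I_m, i \in A -> (i < n.+1)%N) ->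
    i == n :> nat -> forall j : 'I_m, j \in A :\ i -> (j < n)%N.
  move=> An /eqP i_n j; rewrite in_setD1 => /andP[ji /An].
  rewrite ltnS leq_eqVlt => /orP[/eqP jc|//].
  by case/eqP: ji; apply: val_inj; rewrite /= jc i_n.
case: (pickP (fun i : 'I_m => i == n :> nat)) => [i i_n|no]; last first.
  by apply: IH => // i => [/In|/Jn]; rewrite ltnS leq_eqVlt no.
have out (A : {set 'I_m}) : i \notin A -> A :\ i = A.
  by move=> iA; apply/setDidPl; rewrite disjoint_sym disjoints1.
have LI := low I i In i_n; have LJ := low J i Jn i_n.
have := wt_lt LI; have := wt_lt LJ; move: (eqP i_n) => ein.
case: (boolP (i \in I)) => iI; case: (boolP (i \in J)) => iJ.
- move=> _ _; rewrite -(setD1K iI) -(setD1K iJ); congr (_ |: _).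
  by apply: IH => //; move: E; rewrite (wtD1 iI) (wtD1 iJ) => /addnI.
- rewrite (out J) // -E (wtD1 iI) ein => h _; move: h.
  by rewrite ltnNge leq_addr.
- rewrite (out I) // E (wtD1 iJ) ein => _; by rewrite ltnNge leq_addr.
- move=> _ _; apply: IH => //; [by rewrite -(out I)|by rewrite -(out J)].
Qed.

End Weight.

Section Alternating.
Variables (K : fieldType) (char2 : 2%N \in [pchar K]).
Variables (T : finType) (g : grading K T).
Implicit Types (A B C I J : {set T}) (x y e a : K) (f psi rho : {set T} -> K).

Lemma sqr_sum (J : Type) (r : seq J) (P : pred J) (F : J -> K) :
  (\sum_(j <- r | P j) F j) ^+ 2 = \sum_(j <- r | P j) F j ^+ 2.
Proof. by apply: (big_morph _ (sqrD char2)); rewrite expr0n. Qed.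

(** The tensors of [K (x)_E K] are written [\sum_A b^A (x) (b^A)^-1 f A], with
    [b^A] the product of the [b_i] for [i] in [A]. The component [C] of [f A] is the
    coefficient at [b^A (x) b^(A + C)], and exchanging the factors replaces [A] by
    [A + C]: the condition describes the alternating tensors. *)
Definition alt psi :=
  forall A C, g C (psi A) = if C == set0 then 0 else g C (psi (symd A C)).

Lemma alt_add f psi : alt f -> alt psi -> alt (fun A => f A + psi A).
Proof.
move=> af ap A C; rewrite !grD af ap; case: eqP; by rewrite ?addr0.
Qed.

Lemma alt_eq f psi : f =1 psi -> alt f -> alt psi.
Proof. by move=> fp af A C; rewrite -!fp af. Qed.

Lemma alt0 : alt (fun _ => 0).
Proof. by move=> A C; rewrite !gr0 if_same. Qed.

Lemma alt_sum (J : Type) (r : seq J) (F : J -> {set T} -> K) :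
  (forall j, alt (F j)) -> alt (fun A => \sum_(j <- r) F j A).
Proof.
move=> aF; elim: r => [|j r IH].
  by apply: alt_eq alt0 => A; rewrite big_nil.
by apply: alt_eq (alt_add (aF j) IH) => A; rewrite big_cons.
Qed.

(** The coefficient of [f] at [\prod_(i in I) (b_i (x) b_i^-1 - 1)]. The tensors in
    the [k]-th power of the kernel of multiplication are those with
    [hat f I = 0] for [#|I| < k], and the values at [#|I| = k] are the coefficients
    of the leading form in the basis of the products of the [dlog b_i]. *)
Definition hat f I := \sum_(A : {set T} | I \subset A) f A.

Lemma hatD f f' I : hat (fun A => f A + f' A) I = hat f I + hat f' I.
Proof. exact: big_split. Qed.

Lemma hat_sqr f I : hat (fun A => f A ^+ 2) I = hat f I ^+ 2.
Proof. by rewrite /hat sqr_sum. Qed.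

Lemma gr_hat C f I : g C (hat f I) = hat (fun A => g C (f A)) I.
Proof. exact: gr_sumr. Qed.

(** The component [C] of an alternating tensor is fixed by the multiplication by
    [b^C (x) (b^C)^-1 = \prod_(i in C) (1 + delta_i)], where
    [delta_i = b_i (x) b_i^-1 - 1]; expanding the product gives the sum. *)
Lemma alt_hat psi C I : alt psi ->
  \sum_(J : {set T} | (I :\: C \subset J) && (J \subset I)) g C (hat psi J) =
  if C == set0 then 0 else g C (hat psi I).
Proof.
move=> ap; have ap0 A : g set0 (psi A) = 0 by rewrite ap eqxx.
case: eqP => [->|/eqP C0].
  by rewrite big1 // => J _; rewrite gr_hat /hat big1.
transitivity (\sum_A (I :\: C == I :&: A)%:R * g C (psi A)).
  transitivity (\sum_A \sum_(J : {set T} | (I :\: C \subset J) && (J \subset I :&: A))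
      g C (psi A)); last by apply: eq_bigr => A _; rewrite (sum_interval char2).
  under [RHS]eq_bigr do rewrite big_mkcond.
  rewrite exchange_big /= [LHS]big_mkcond; apply: eq_bigr => J _.
  rewrite gr_hat /hat; case: ifP => [/andP[cJ JI]|nJ].
    by rewrite big_mkcond; apply: eq_bigr => A _; rewrite subsetI cJ JI.
  by rewrite big1 // => A _; rewrite subsetI andbA nJ.
rewrite gr_hat /hat [RHS]big_mkcond (reindex_inj (inv_inj (symdK C))) /=.
apply: eq_bigr => A _; rewrite ap (negPf C0) (symdC C) symdKr.
have -> : (I :\: C == I :&: symd A C) = (I \subset A).
  by rewrite -subset_symd symdKr.
by case: ifP; rewrite ?mul1r ?mul0r.
Qed.

(** The tensor [a (x) e]. *)
Definition tau (p : K * K) A : K := g A p.1 * p.2.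

Lemma tauDr a e e' A : tau (a, e + e') A = tau (a, e) A + tau (a, e') A.
Proof. by rewrite /tau mulrDr. Qed.

Lemma tau_bal a s e A : tau (a * s ^+ 2, e) A = tau (a, s ^+ 2 * e) A.
Proof. by rewrite /tau /= [a * _]mulrC gr0M ?(gr_sqr char2) ?eqxx // -mulrA mulrCA. Qed.

Lemma tau_swap a e : alt (fun A => tau (a, e) A + tau (e, a) A).
Proof.
have E A C : g C (tau (a, e) A + tau (e, a) A) =
    g A a * g (symd A C) e + g A e * g (symd A C) a.
  by rewrite grD /tau /= !grM; congr (_ + _); rewrite (bigD1 A) //= gr_gr eqxx
     big1 ?addr0 // => B BA; rewrite gr_gr (negPf BA) mul0r.
move=> A C; rewrite !E; case: eqP => [->|_].
  by rewrite symd0 [X in _ + X]mulrC (addKK char2).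
by rewrite symdKr addrC mulrC [X in _ + X]mulrC.
Qed.

(** The difference consists of the cross terms of [a * a], with [a] decomposed into
    its homogeneous parts; they form an alternating tensor. *)
Lemma tau_frob a e : alt (fun A => tau (a, e) A ^+ 2 + tau (a, a * e ^+ 2) A).
Proof.
have E A C : g C (tau (a, e) A ^+ 2 + tau (a, a * e ^+ 2) A) =
    if C == set0 then 0 else e ^+ 2 * (g A a * g (symd A C) a).
  rewrite grD (gr_sqr char2) /tau /= mulrA [_ * e ^+ 2]mulrC gr0M ?(gr_sqr char2) ?eqxx //.
  rewrite grM (bigD1 A) //= gr_gr eqxx big1 ?addr0 => [|B BA]; last first.
    by rewrite gr_gr (negPf BA) mul0r.
  case: eqP => [->|_]; last by rewrite add0r.
  by rewrite symd0 exprMn -expr2 mulrC (addKK char2).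
move=> A C; rewrite !E; case: eqP => // _.
by rewrite symdKr; congr (_ * _); exact: mulrC.
Qed.

Definition tensor_of (l : seq (K * K)) A := \sum_(p <- l) tau p A.

Definition hat_list (l : seq (K * K)) I := \sum_(p <- l) pderiv g I p.1 * p.2.

Lemma hat_tsum l I : hat (tensor_of l) I = hat_list l I.
Proof.
rewrite /hat /tensor_of exchange_big /=; apply: eq_bigr => p _.
by rewrite /tau -mulr_suml.
Qed.

End Alternating.

(** * Leading forms *)

Section Leading.
Variables (K : fieldType) (char2 : 2%N \in [pchar K]).
Variables (m : nat) (g : grading K 'I_m).
Implicit Types (A B C I J s : {set 'I_m}) (x y e a : K) (f psi rho : {set 'I_m} -> K).
Implicit Types (l : seq (K * K)) (ys : seq K).

Local Notation tsum := (tensor_of g).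
Local Notation hatl := (hat_list g).
Local Notation D := (pderiv g).

Definition dominated s a :=
  forall C, C != set0 -> g C a != 0 ->
  exists2 c, c \in s & c \in C /\ forall i : 'I_m, i \in C -> (i <= c)%N.

(** The equation [r^2 + r + rho] alternating says, in a degree [j] below that of
    [rho] and on the component [C], that [dlog b^C] annihilates the leading form
    of [r]. If the largest element [c] of [C] were outside the extremal set [s],
    the coefficient of this product at [c |: s] would be the component [C] of
    the leading coefficient [a] alone. On the component of degree zero the equation
    reads [a^2 = gr set0 a]. *)
Lemma alt_top j l rho s (a := hatl l s) :
  alt g (fun A => tsum l A ^+ 2 + tsum l A + rho A) ->
  (forall I, (#|I| <= j)%N -> hat rho I = 0) ->
  (forall I, (#|I| < j)%N -> hatl l I = 0) ->
  #|s| = j -> (forall I, #|I| = j -> (wt s < wt I)%N -> hatl l I = 0) ->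
  g set0 a = a ^+ 2 /\ dominated s a.
Proof.
set psi := fun A => _; move=> ap rho0 l0 sj top.
have hE I : hat psi I = hatl l I ^+ 2 + hatl l I + hat rho I.
  by rewrite /psi !hatD hat_sqr // hat_tsum.
split.
  have := alt_hat char2 set0 s ap; rewrite eqxx setD0.
  rewrite (big_pred1 s) => [|J]; last by rewrite /= [RHS]eq_sym eqEsubset.
  rewrite hE rho0 ?sj // addr0 grD (gr_sqr char2) eqxx => /(eq_addr0 char2).
  by move->.
move=> C /set0Pn[i0 i0C] aC.
have [c cC cmax] : exists2 c, c \in C & forall i : 'I_m, i \in C -> (i <= c)%N.
  by case: (arg_maxnP (fun i : 'I_m => i : nat) i0C) => c cC cm; exists c.
case: (boolP (c \in s)) => cs; first by exists c.
case/eqP: aC; pose I := c |: s.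
have C0 : C != set0 by apply/set0Pn; exists i0.
have cI : #|I| = j.+1 by rewrite cardsU1 cs sj.
have := alt_hat char2 C I ap; rewrite (negPf C0) (bigD1 I) /=; last first.
  by rewrite subsetDl subxx.
move/(canRL (addKr _)); rewrite addNr.
have sI : (I :\: C \subset s) && (s \subset I).
  rewrite subsetUr andbT; apply/subsetP => i; rewrite !inE => /andP[iC].
  by case: eqP => [ei|//]; rewrite ei cC in iC.
have sNI : s != I by apply: contraNneq cs => ->; rewrite setU11.
rewrite (bigD1 s) /=; last by rewrite sI sNI.
rewrite big1 ?addr0 => [|J /andP[/andP[/andP[CJ JI] JNI] JNs]].
  rewrite hE rho0 ?sj // addr0 grD (gr_sqr char2) (negPf C0) add0r; exact: id.
have ltJ : (#|J| <= j)%N.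
  by rewrite -ltnS -cI; apply: proper_card; rewrite properEneq JNI JI.
suff lJ : hatl l J = 0.
  by rewrite hE rho0 // lJ expr0n /= !addr0 gr0.
move: ltJ; rewrite leq_eqVlt => /orP[/eqP Jj|]; last exact: l0.
apply: top => //.
have cJ : c \in J.
  apply: contraR JNs => cJ; rewrite eqEcard Jj sj leqnn andbT.
  apply/subsetP => i iJ; have := subsetP JI i iJ; rewrite !inE.
  by case: eqP => // ei; rewrite -ei iJ in cJ.
have [i iS iJ] : exists2 i, i \in s & i \notin J.
  apply/subsetPn; apply: contra JNI => sJ; rewrite eqEsubset JI.
  by rewrite subUset sub1set cJ.
have iC : i \in C.
  apply: contraR iJ => iC; apply: (subsetP CJ); rewrite !inE iC iS orbT //.
have ic : (i < c)%N.
  rewrite ltn_neqAle cmax // andbT; apply: contraNneq cs => /val_inj <-.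
  by [].
have E : J :\ c = s :\ i.
  apply/eqP; rewrite eqEcard; apply/andP; split.
    apply/subsetP => x; rewrite !in_setD1 => /andP[xc xJ].
    have := subsetP JI x xJ; rewrite !inE (negPf xc) /= => ->; rewrite andbT.
    by apply: contraNneq iJ => <-.
  have := cardsD1 c J; have := cardsD1 i s; rewrite cJ iS Jj sj => -> /addnI ->.
  by [].
by rewrite (wtD1 iS) (wtD1 cJ) E ltn_add2r ltn_exp2l.
Qed.

(** The form [[1, alpha]] tensored with [<1, y>] for each slot [y], using that
    [y [a, e] = [y a, e / y]]. *)
Fixpoint pfister (F : fieldType) (alpha : F) (ys : seq F) : seq (F * F) :=
  if ys is y :: ys' then
    pfister alpha ys' ++ [seq (y * p.1, p.2 / y) | p <- pfister alpha ys']
  else [:: (1, alpha)].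

Lemma hatl_cat l1 l2 I : hatl (l1 ++ l2) I = hatl l1 I + hatl l2 I.
Proof. exact: big_cat. Qed.

Lemma tsum_cat l1 l2 A : tsum (l1 ++ l2) A = tsum l1 A + tsum l2 A.
Proof. exact: big_cat. Qed.

(** A slot multiplies the tensor by [y (x) y^-1 - 1], whose coefficients are the
    [pderiv J y / y] for nonempty [J]. *)
Lemma hatl_pf_cons alpha y ys I : y != 0 ->
  hatl (pfister alpha (y :: ys)) I =
  \sum_(J : {set 'I_m} | (J \subset I) && (J != set0))
     D J y / y * hatl (pfister alpha ys) (I :\: J).
Proof.
move=> y0; rewrite /= hatl_cat; set l := pfister alpha ys.
have -> : hatl [seq (y * p.1, p.2 / y) | p <- l] I =
    \sum_(J : {set 'I_m} | J \subset I) D J y / y * hatl l (I :\: J).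
  rewrite /hat_list big_map; under eq_bigr do rewrite /= (DM char2) mulr_suml.
  rewrite exchange_big /=; apply: eq_bigr => J _; rewrite mulr_sumr.
  by apply: eq_bigr => p _; rewrite [p.2 / y]mulrC mulrACA.
rewrite (bigD1 set0) ?sub0set //= D0 divff // mul1r setD0 addrA addKK //.
exact: add0r.
Qed.

Lemma pf_low alpha ys I : all (fun y => y != 0) ys ->
  (#|I| < size ys)%N -> hatl (pfister alpha ys) I = 0.
Proof.
elim: ys I => [//|y ys IH] I /= /andP[y0 ys0] Iy.
rewrite (hatl_pf_cons alpha ys I y0) big1 // => J /andP[JI J0].
rewrite IH ?mulr0 // cardsDS //.
have J_gt0 : (0 < #|J|)%N by rewrite card_gt0.
have := subset_leq_card JI; move: Iy J_gt0.
by move: #|I| #|J| (size ys) => cI cJ n; lia.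
Qed.

(** The coefficient of [dlog y] at [dlog b_i]. *)
Definition dlog_coef i y := D [set i] y / y.

Local Notation dlogc := dlog_coef.

Lemma pf_lead alpha y ys I : y != 0 -> all (fun y => y != 0) ys ->
  #|I| = (size ys).+1 ->
  hatl (pfister alpha (y :: ys)) I =
  \sum_(i in I) dlogc i y * hatl (pfister alpha ys) (I :\ i).
Proof.
move=> y0 ys0 Iy; rewrite (hatl_pf_cons alpha ys I y0).
rewrite -[RHS](big_imset (h := set1)
  (fun J : {set 'I_m} => D J y / y * hatl (pfister alpha ys) (I :\: J))) /=; last first.
  by move=> i j _ _; exact: (@set1_inj _ i j).
rewrite [LHS]big_mkcond [RHS]big_mkcond; apply: eq_bigr => J _.
case: ifP => [/andP[JI J0]|nJ].
  case: (boolP (J \in _)) => // JN; rewrite pf_low ?mulr0 // cardsDS // Iy.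
  have : #|J| != 1%N.
    apply: contra JN => /cards1P[i Ji]; apply/imsetP; exists i => //.
    by move: JI; rewrite Ji sub1set.
  have : (0 < #|J|)%N by rewrite card_gt0.
  have := subset_leq_card JI; rewrite Iy.
  by move: #|J| (size ys) => cJ n; lia.
case: ifP => // /imsetP[i iI Ji]; move: nJ; rewrite Ji sub1set iI /=.
by move=> /negbFE; rewrite -subset0 sub1set inE.
Qed.

Lemma dlogcM i x y : x != 0 -> y != 0 -> dlogc i (x * y) = dlogc i x + dlogc i y.
Proof.
move=> x0 y0; rewrite /dlog_coef (DM char2) (bigD1 set0) ?sub0set //=.
rewrite (big_pred1 [set i]) => [|J]; last first.
  rewrite /= subset1; case: eqP => [->|_] /=.
    by rewrite -subset0 sub1set inE.
  by case: eqP.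
rewrite setD0 setDv !D0 addrC mulrDl; congr (_ + _).
  by rewrite invfM mulrACA divff // mulr1.
by rewrite invfM mulrACA divff // mul1r.
Qed.

End Leading.

Section Logarithmic.
Variables (K : fieldType) (char2 : 2%N \in [pchar K]).
Variables (m : nat) (g : grading K 'I_m) (b : 'I_m -> K).
Implicit Types (A B C I J s : {set 'I_m}) (x y e a : K) (f psi rho : {set 'I_m} -> K).
Implicit Types (l : seq (K * K)) (ys : seq K).

Local Notation tsum := (tensor_of g).
Local Notation hatl := (hat_list g).
Local Notation D := (pderiv g).
Local Notation dlogc := (dlog_coef g).

Definition generator i := b i != 0 /\ g [set i] (b i) = b i.

Lemma gr_D C I x : g C (D I x) = if I \subset C then g C x else 0.
Proof.
rewrite /pderiv gr_sumr; case: ifP => IC.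
  rewrite (bigD1 C) //= gr_gr eqxx big1 ?addr0 // => A /andP[_ AC].
  by rewrite gr_gr eq_sym (negPf AC).
rewrite big1 // => A IA; rewrite gr_gr; case: eqP => // CA.
by move: IA; rewrite -CA IC.
Qed.

Lemma D_eq0 x i I : (forall A, i \in A -> g A x = 0) -> i \in I -> D I x = 0.
Proof. by move=> x0 iI; rewrite /pderiv big1 // => A /subsetP IA; apply: x0; apply: IA. Qed.

Lemma grM_eq0 x y i : (forall A, i \in A -> g A x = 0) ->
  (forall A, i \in A -> g A y = 0) -> forall A, i \in A -> g A (x * y) = 0.
Proof.
move=> x0 y0 C iC; rewrite grM big1 // => A _.
case: (boolP (i \in A)) => iA; first by rewrite x0 ?mul0r.
by rewrite y0 ?mulr0 // in_symd (negPf iA).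
Qed.

Lemma dlogc_top c S x : x = D [set c] S -> x != 0 -> S != 0 ->
  dlogc c (x * S) = (S + x) / S.
Proof.
move=> xE x0 S0; rewrite (dlogcM char2) // mulrDl divff //; congr (_ + _).
  suff Dx : D [set c] x = x by rewrite /dlog_coef Dx divff.
  by rewrite [RHS]xE /pderiv; apply: eq_bigr => A cA; rewrite xE gr_D cA.
by rewrite /dlog_coef -xE.
Qed.

(** The inverse of [S = 1 + \sum_(i in s) x_i], where every monomial of [x_i] has
    largest index [i], is the leading coefficient of the logarithmic form
    [\prod_i dlog (x_i S_i)] with [S_i = 1 + \sum_(j in s | j <= i) x_j]: the
    coefficient of [dlog (x_i S_i)] at [dlog b_i] is [1 + x_i / S_i], the quotient of
    the preceding partial sum by [S_i], so that the product telescopes. If [x_i = 0]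
    the partial sum does not change, and [dlog b_i] is used. *)
Lemma log_leading s S : (forall i, i \in s -> generator i) ->
  g set0 S = 1 -> dominated g s S ->
  exists ys, [/\ all (fun y => y != 0) ys, size ys = #|s|,
    hatl (pfister 1 ys) s = S^-1,
    forall I, #|I| = #|s| -> (wt s < wt I)%N -> hatl (pfister 1 ys) I = 0 &
    forall I (i : 'I_m), i \in I -> (forall j : 'I_m, j \in s -> (j < i)%N) ->
      hatl (pfister 1 ys) I = 0].
Proof.
elim: {s}#|s| {-2}s (erefl #|s|) S => [|n IH] s sn S sgen S0 Sdom.
  have s0 : s = set0 by apply: cards0_eq.
  have S1 : S = 1.
    rewrite -(gr_sum g S) (bigD1 set0) //= S0 big1 ?addr0 // => C C0.
    apply/eqP; case: eqP => // /eqP /(Sdom C C0) [c].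
    by rewrite s0 inE.
  have hE I : hatl (pfister 1 [::]) I = (I == set0)%:R.
    by rewrite /hat_list big_seq1 /= (D1 char2) mulr1.
  exists [::]; split=> //; rewrite ?hE ?s0 ?eqxx ?S1 ?invr1 //.
    by move=> I /eqP; rewrite cards0 cards_eq0 => /eqP ->; rewrite ltnn.
  by move=> I i iI _; rewrite hE; case: eqP iI => // ->; rewrite inE.
have [i0 i0s] : exists i, i \in s by apply/set0Pn; rewrite -card_gt0 sn.
have [c cs cmax] : exists2 c, c \in s & forall i : 'I_m, i \in s -> (i <= c)%N.
  by case: (arg_maxnP (fun i : 'I_m => i : nat) i0s) => c cs cm; exists c.
set s' := s :\ c; have s'n : #|s'| = n.
  by move: (cardsD1 c s); rewrite cs sn => -[].
have s'c (j : 'I_m) : j \in s' -> (j < c)%N.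
  rewrite in_setD1 => /andP[jc js]; rewrite ltn_neqAle cmax // andbT.
  by apply: contraNneq jc => /val_inj ->.
have S_top A (i : 'I_m) : i \in A -> (c < i)%N -> g A S = 0.
  move=> iA ci; apply/eqP; case: eqP => // /eqP SA.
  have [|d ds [dA /(_ i iA) di]] := Sdom A _ SA; first by apply/set0Pn; exists i.
  by have := leq_trans (leq_trans ci di) (cmax d ds); rewrite ltnn.
have S_neq0 : S != 0 by apply: contra_eq_neq S0 => ->; rewrite gr0 eq_sym oner_neq0.
(* the part of S that involves the generator c, and the rest of S *)
pose x := D [set c] S; pose S' := S + x.
have gx A : g A x = if c \in A then g A S else 0 by rewrite gr_D sub1set.
have gS' A : g A S' = if c \in A then 0 else g A S.
  by rewrite grD gx; case: ifP; rewrite ?addr0 ?addKK.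
have S'0 : g set0 S' = 1 by rewrite gS' inE.
have [||||ys [ys0 ysn ysl yst ysv]] := IH s' _ S'.
- by [].
- by move=> i /setD1P[_]; apply: sgen.
- by [].
- move=> C C0; rewrite gS'; case: ifP => [_|cC SC]; first by rewrite eqxx.
  have [d ds [dC dm]] := Sdom C C0 SC; exists d => //.
  by rewrite in_setD1 ds andbT; apply: contraFneq cC => <-.
pose y := if x == 0 then b c else x * S.
have [bc0 bc] := sgen c cs.
have y0 : y != 0 by rewrite /y; case: (x =P 0) => // /eqP x0; apply: mulf_neq0.
have yc : dlogc c y = S' / S.
  rewrite /y; case: eqP => [x0|/eqP x0]; last exact: dlogc_top.
  rewrite /S' x0 addr0 divff // /dlog_coef.
  suff -> : D [set c] (b c) = b c by rewrite divff.
  rewrite -{2}bc /pderiv (bigD1 [set c]) //= big1 ?addr0 // => A /andP[_ Ac].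
  by rewrite -bc gr_gr (negPf Ac).
have y_top (i : 'I_m) : (c < i)%N -> forall A, i \in A -> g A y = 0.
  move=> ci; have x_top A : i \in A -> g A x = 0.
    by move=> iA; rewrite gx (S_top A i) // if_same.
  rewrite /y; case: eqP => _; last by apply: grM_eq0 => // A iA; apply: S_top ci.
  move=> A iA; rewrite -bc gr_gr; case: eqP => // Ac.
  by move: iA ci; rewrite Ac inE => /eqP ->; rewrite ltnn.
exists (y :: ys); have ysz : size ys = n by rewrite ysn.
have lead I : #|I| = n.+1 -> hatl (pfister 1 (y :: ys)) I =
    \sum_(i in I) dlogc i y * hatl (pfister 1 ys) (I :\ i).
  by move=> In; apply: pf_lead => //; rewrite ysz.
split; rewrite ?sn /=.
- by rewrite y0.
- by rewrite ysz.
- rewrite lead // (bigD1 c) //= yc ysl big1 ?addr0 => [|i /andP[iS ic]].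
    rewrite mulrAC divff ?mul1r //.
    by apply: contra_eq_neq S'0 => ->; rewrite gr0 eq_sym oner_neq0.
  by rewrite (ysv _ c) ?mulr0 // in_setD1 eq_sym ic.
- move=> I In sI; rewrite [LHS]lead // big1 // => i iI.
  case: (boolP [exists k in I, (c < k)%N]) => [/exists_inP[k kI ck]|/exists_inPn Ic].
    case: (eqVneq i k) => [->|ik].
      by rewrite /dlog_coef (D_eq0 (y_top k ck)) ?set11 // !mul0r.
    rewrite (ysv _ k) ?mulr0 ?in_setD1 1?eq_sym ?ik // => j /s'c jc.
    exact: ltn_trans jc ck.
  have cI : c \in I.
    apply: contraLR sI => cI; rewrite -leqNgt.
    apply: (@leq_trans (2 ^ c)); last by rewrite (wtD1 cs) leq_addr.
    apply/ltnW/wt_lt => k kI; rewrite ltn_neqAle leqNgt Ic // andbT.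
    by apply: contraNneq cI => /val_inj <-.
  case: (eqVneq i c) => [->|ic]; last first.
    by rewrite (ysv _ c) ?mulr0 // in_setD1 eq_sym ic.
  rewrite yst ?mulr0 //; last by move: sI; rewrite (wtD1 cs) (wtD1 cI) ltn_add2l.
  by move: (cardsD1 c I); rewrite cI In s'n => -[].
- move=> I i iI is_; have ci := is_ c cs.
  rewrite -/(pfister 1 (y :: ys)) (hatl_pf_cons char2) // big1 // => J /andP[JI J0].
  case: (boolP (i \in J)) => iJ; first by rewrite (D_eq0 (y_top i ci)) ?mul0r.
  by rewrite (ysv _ i) ?mulr0 ?inE ?iJ // => j /s'c jc; apply: ltn_trans jc ci.
Qed.

End Logarithmic.

(** * Kato's theorem for leading forms *)

Section GradedPiece.
Variables (K : fieldType) (char2 : 2%N \in [pchar K]).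
Variables (m : nat) (g : grading K 'I_m) (b : 'I_m -> K).
Hypothesis gen : forall (A : {set 'I_m}) x i, i \in A -> g A x != 0 -> generator g b i.
Implicit Types (A B C I J s : {set 'I_m}) (x y e a : K) (f psi rho : {set 'I_m} -> K).
Implicit Types (l : seq (K * K)) (ys : seq K).

Local Notation tsum := (tensor_of g).
Local Notation hatl := (hat_list g).
Local Notation D := (pderiv g).

Local Notation frob l rho := (fun A => tsum l A ^+ 2 + tsum l A + rho A).

(** The pairs are [(y, y^-1)], which the map [a (x) e |-> a (x) a e^2] fixes: the
    Pfister form of [dlog y_1 /\ ... /\ dlog y_k] solves [r^2 + r = 0] up to
    alternating tensors. *)
Lemma pf1_pairs ys p : all (fun y => y != 0) ys -> p \in pfister 1 ys ->
  p.1 * p.2 ^+ 2 = p.2.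
Proof.
elim: ys p => [|y ys IH] p /=; first by rewrite inE => _ /eqP -> /=; rewrite expr1n mulr1.
move=> /andP[y0 ys0]; rewrite mem_cat => /orP[/IH->//|/mapP[q ql ->] /=].
rewrite -[in RHS](IH q) // !expr2; field.
exact: y0.
Qed.

Lemma alt_pf1 ys : all (fun y => y != 0) ys ->
  alt g (fun A => tsum (pfister 1 ys) A ^+ 2 + tsum (pfister 1 ys) A).
Proof.
move=> ys0; set l := pfister 1 ys.
apply: (alt_eq (f := fun A => \sum_(p <- l) (tau g p A ^+ 2 + tau g (p.1, p.1 * p.2 ^+ 2) A))).
  move=> A; rewrite big_split /= /tensor_of sqr_sum //; congr (_ + _).
  by apply: eq_big_seq => p pl; rewrite (pf1_pairs ys0 pl); case: p {pl}.
by apply: alt_sum => -[a e]; apply: tau_frob.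
Qed.

Lemma frob_cat l1 l2 rho :
  alt g (frob l1 rho) -> alt g (fun A => tsum l2 A ^+ 2 + tsum l2 A) ->
  alt g (frob (l1 ++ l2) rho).
Proof.
move=> a1 a2; apply: alt_eq (alt_add a1 a2) => A.
rewrite /= tsum_cat sqrD //; ring.
Qed.

(** In a degree [j] below that of [rho], the leading form of a solution [r] of
    [r^2 + r = rho] is in the kernel of the Artin-Schreier map. Its extremal
    coefficient [a] satisfies [a^-1 = a^-2 a], whose components are those of [a]
    up to a constant, hence is the leading coefficient of a logarithmic form, which
    can be subtracted from [r]. *)
Lemma frob_low k l rho : alt g (frob l rho) ->
  (forall I, (#|I| < k)%N -> hat rho I = 0) ->
  exists2 l', alt g (frob l' rho) & forall I, (#|I| < k)%N -> hatl l' I = 0.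
Proof.
move=> al rho0.
suff W j : (j <= k)%N ->
    exists2 l', alt g (frob l' rho) & forall I, (#|I| < j)%N -> hatl l' I = 0.
  exact: W.
elim: j => [|j IH] jk; first by exists l.
have {l al} [l al l0] := IH (ltnW jk).
suff {l al l0} W w l : alt g (frob l rho) -> (forall I, (#|I| < j)%N -> hatl l I = 0) ->
    (forall I, #|I| = j -> (w <= wt I)%N -> hatl l I = 0) ->
    exists2 l', alt g (frob l' rho) & forall I, (#|I| < j.+1)%N -> hatl l' I = 0.
  apply: (W (2 ^ m)%N l) => // I _; rewrite leqNgt wt_lt // => i _; exact: ltn_ord.
elim: w l => [|w IHw] l al l0 lw.
  exists l => // I; rewrite ltnS leq_eqVlt => /orP[/eqP Ij|]; last exact: l0.
  exact: lw.
case: (pickP (fun s : {set 'I_m} => [&& #|s| == j, wt s == w & hatl l s != 0]))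
    => [s /and3P[/eqP sj /eqP sw a0]|no]; last first.
  apply: (IHw l) => // I Ij; rewrite leq_eqVlt => /orP[/eqP wI|]; last exact: lw.
  by have := no I; rewrite Ij -wI !eqxx /= => /negbFE /eqP.
have top I : #|I| = j -> (wt s < wt I)%N -> hatl l I = 0.
  by move=> Ij; rewrite sw; apply: lw.
have rho_j I : (#|I| <= j)%N -> hat rho I = 0.
  by move=> Ij; apply: rho0; apply: leq_ltn_trans Ij jk.
have [a_0 a_dom] := alt_top char2 al rho_j l0 sj top.
set a := hatl l s in a0 a_0 a_dom.
have aV : a^-1 = a^-1 ^+ 2 * a by rewrite expr2 -mulrA mulVf // mulr1.
have gV C : g C a^-1 = a^-1 ^+ 2 * g C a.
  by rewrite {1}aV gr0M // (gr_sqr char2) eqxx.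
have [i is_|||ys [ys0 ysn ysl yst _]] := @log_leading _ char2 _ g b s a^-1.
- have [p [A [iA pA]]] : exists (p : K * K) A, i \in A /\ g A p.1 != 0.
    apply: contrapT => no; case/eqP: a0; rewrite /a /hat_list big1 // => p _.
    rewrite (@D_eq0 _ _ _ _ i) ?mul0r // => A iA.
    by apply: contrapT => /eqP pA; apply: no; exists p, A.
  exact: gen iA pA.
- by rewrite gV a_0 -exprMn mulVf // expr1n.
- move=> C C0; rewrite gV => /negP H; apply: a_dom => //.
  by apply/negP => /eqP aC; apply: H; rewrite aC mulr0.
rewrite invrK in ysl.
apply: (IHw (l ++ pfister 1 ys)).
- exact: frob_cat (alt_pf1 ys0).
- by move=> I Ij; rewrite hatl_cat l0 // (pf_low char2) ?addr0 // ysn sj.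
- move=> I Ij wI; rewrite hatl_cat; case: (eqVneq I s) => [->|Is].
    by rewrite ysl -/a addKK.
  have sI : (wt s < wt I)%N.
    by rewrite ltn_neqAle sw wI andbT -sw; apply: contraNneq Is => /wt_inj ->.
  by rewrite top // yst ?addr0 // Ij sj.
Qed.

Variables (G : zmodType) (S : K -> {set 'I_m} -> G) (N : G -> Prop) (k : nat).
Hypothesis SD : forall x y I, S (x + y) I = S x I + S y I.
Hypothesis N0 : N 0.
Hypothesis ND : forall z w, N z -> N w -> N (z + w).
Hypothesis N_wp : forall a I, #|I| = k.+1 -> N (S (a ^+ 2 + a) I).
Hypothesis N_exact : forall C J x, C != set0 -> #|J| = k ->
  N (\sum_(i in C :\: J) S (g C x) (i |: J)).

Let S0 I : S 0 I = 0.
Proof. by apply: (addrI (S 0 I)); rewrite -SD !addr0. Qed.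

Let S_sum (J : Type) (r : seq J) (P : pred J) (F : J -> K) I :
  S (\sum_(j <- r | P j) F j) I = \sum_(j <- r | P j) S (F j) I.
Proof. by apply: (big_morph (S^~ I) (fun x y => SD x y I) (S0 I)). Qed.

Lemma N_sum (J : Type) (r : seq J) (P : pred J) (F : J -> G) :
  (forall j, P j -> N (F j)) -> N (\sum_(j <- r | P j) F j).
Proof. by move=> NF; apply: big_ind. Qed.

(** The component [C] of the leading form [h] of an alternating tensor satisfies
    [dlog b^C /\ h = 0], hence [h = dlog b^C /\ h'], where [h'] collects the terms of
    [h] that contain [dlog b_c], for a fixed [c] in [C]. As [h'] is [b^C] times a
    combination with constant coefficients of products of [dlog b_i], this is the
    differential of [h']. *)
Lemma alt_exact psi C : alt g psi -> (forall I, (#|I| < k.+1)%N -> hat psi I = 0) ->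
  C != set0 -> N (\sum_(I : {set 'I_m} | #|I| == k.+1) S (g C (hat psi I)) I).
Proof.
move=> ap low C0; have [c cC] := set0Pn _ C0.
pose h I := g C (hat psi I).
have swap I : #|I| = k.+1 -> c \notin I ->
    h I = \sum_(i in C :&: I) h (c |: (I :\ i)).
  move=> Ik cI; pose I' := c |: I.
  have cI' : #|I'| = k.+2 by rewrite cardsU1 cI Ik.
  have := alt_hat char2 C I' ap; rewrite (negPf C0) (bigD1 I') /=; last first.
    by rewrite subsetDl subxx.
  move/(canRL (addKr _)); rewrite addNr (bigD1 I) /=; last first.
    rewrite subsetUr andbT; apply/andP; split.
      apply/subsetP => i; rewrite !inE => /andP[iC]; case: eqP => [ei|//].
      by rewrite ei cC in iC.
    by apply: contraNneq cI => ->; rewrite setU11.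
  move/(eq_addr0 char2) => E; rewrite [LHS]E {E}.
  rewrite -[RHS](big_imset (h := fun i => c |: (I :\ i)) h) /=; last first.
    move=> i j; rewrite !inE => /andP[_ iI] /andP[_ jI] /setP /(_ i).
    have ic : (i == c) = false by apply: contraNF cI => /eqP <-.
    by rewrite !inE eqxx iI ic /= andbT => E; apply/eqP; rewrite -[_ == _]negbK -E.
  rewrite [LHS]big_mkcond [RHS]big_mkcond; apply: eq_bigr => J _.
  case: ifP => [/andP[/andP[/andP[CJ JI] JNI] JI0]|nJ].
    have JltI : (#|J| <= k.+1)%N.
      by rewrite -ltnS -cI'; apply: proper_card; rewrite properEneq JNI JI.
    case: ifP => // /negP nimg; move: JltI; rewrite leq_eqVlt => /orP[/eqP Jk|Jk]; last first.
      by rewrite /h low // gr0.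
    case: nimg.
    have cJ : c \in J.
      apply: contraR JI0 => cJ; rewrite eqEcard Jk Ik leqnn andbT.
      apply/subsetP => i iJ; have := subsetP JI i iJ; rewrite !inE.
      by case: eqP => // ei; rewrite -ei iJ in cJ.
    have [i iI iJ] : exists2 i, i \in I & i \notin J.
      apply/subsetPn; apply: contra JNI => sJ; rewrite eqEsubset JI.
      by rewrite subUset sub1set cJ.
    apply/imsetP; exists i.
      rewrite inE iI andbT; apply: contraR iJ => iC.
      by apply: (subsetP CJ); rewrite !inE iC iI orbT.
    apply/eqP; rewrite eqEcard; apply/andP; split.
      apply/subsetP => j jJ; have := subsetP JI j jJ; rewrite !inE.
      case: (j =P c) => //= _ ->; rewrite andbT.
      by apply: contraNneq iJ => <-.
    rewrite cardsU1 !inE (negPf cI) andbF Jk /= add1n ltnS.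
    by move: (cardsD1 i I); rewrite iI Ik => -[->].
  case: ifP => // /imsetP[i]; rewrite inE => /andP[iC iI] Ji.
  move: nJ; rewrite Ji => /negP[]; apply/andP; split; last first.
    by apply: contraNneq cI => <-; rewrite setU11.
  apply/andP; split; last first.
    apply/negP => /eqP /setP /(_ i); rewrite !inE eqxx iI orbT /= orbF => /eqP ic.
    by move: cI; rewrite -ic iI.
  apply/andP; split; last by rewrite setUS // subsetDl.
  apply/subsetP => j; rewrite !inE => /andP[jC] /orP[->//|jI].
  rewrite jI andbT; apply/orP; right; apply: contraNneq jC => ->.
  exact: iC.
rewrite (bigID (fun I : {set 'I_m} => c \in I)) /=.
have -> : \sum_(I : {set 'I_m} | (#|I| == k.+1) && (c \in I)) S (g C (hat psi I)) I =
    \sum_(J : {set 'I_m} | (#|J| == k) && (c \notin J)) S (h (c |: J)) (c |: J).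
  rewrite (reindex_onto (fun J => c |: J) (fun I => I :\ c)) /=; last first.
    by move=> I /andP[_ cI]; rewrite setD1K.
  apply: eq_bigl => J; rewrite setU11 andbT.
  case: (boolP (c \in J)) => cJ /=.
    rewrite andbF; apply/negP => /andP[_ /eqP /setP /(_ c)].
    by rewrite !inE eqxx cJ.
  by rewrite setU1K // eqxx !andbT cardsU1 cJ.
have -> : \sum_(I : {set 'I_m} | (#|I| == k.+1) && (c \notin I)) S (g C (hat psi I)) I =
    \sum_(J : {set 'I_m} | (#|J| == k) && (c \notin J))
      \sum_(i in (C :\: J) :\ c) S (h (c |: J)) (i |: J).
  transitivity (\sum_(I : {set 'I_m} | (#|I| == k.+1) && (c \notin I))
      \sum_(i in C :&: I) S (h (c |: (I :\ i))) I).
    by apply: eq_bigr => I /andP[/eqP Ik cI]; rewrite -/(h I) swap // S_sum.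
  rewrite !pair_big_dep /=.
  rewrite (reindex_onto (fun q : {set 'I_m} * 'I_m => (q.2 |: q.1, q.2))
     (fun q => (q.1 :\ q.2, q.2))) /=; last first.
    by case=> I i /= /andP[_]; rewrite inE => /andP[_ iI]; rewrite setD1K.
  apply: eq_big => [[J i]|[J i]] /=; last first.
    by move=> /andP[_ /eqP[->]].
  rewrite xpair_eqE eqxx andbT !inE eqxx /= andbT.
  case: (boolP (i \in J)) => iJ /=.
    rewrite !andbF; apply/negP => /andP[_ /eqP /setP /(_ i)].
    by rewrite !inE eqxx iJ.
  rewrite setU1K // eqxx andbT cardsU1 iJ add1n eqSS negb_or (eq_sym c).
  by case: (#|J| == k); case: (i == c); case: (c \in J); case: (i \in C).
rewrite -big_split /=; apply: N_sum => J /andP[/eqP Jk cJ].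
rewrite -[S _ _ + _](big_setD1 c) /=; last by rewrite inE cJ cC.
exact: N_exact.
Qed.

(** The part of degree zero of the equation gives [f = a^2 + a], so that [[1, f]]
    vanishes in the Witt group; it is absorbed in the solution by adding
    [1 (x) a]. After [frob_low] the leading forms of [rho] and of [r^2 + r] differ
    by the leading form of an alternating tensor. *)
Lemma nul_leading rho l (f : K) : alt g (fun A => tsum l A ^+ 2 + tsum l A + (rho A + tau g (1, f) A)) ->
  (forall I, (#|I| < k.+1)%N -> hat rho I = 0) ->
  N (\sum_(I : {set 'I_m} | #|I| == k.+1) S (hat rho I) I).
Proof.
move=> al low; pose a := hatl l set0.
have hE I l' : hat (frob l' rho) I = hatl l' I ^+ 2 + hatl l' I + hat rho I.
  by rewrite !hatD hat_sqr // hat_tsum.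
have hf : a ^+ 2 + a = f.
  apply: (eq_addr0 char2).
  have <- : hat (fun A => tsum l A ^+ 2 + tsum l A + (rho A + tau g (1, f) A)) set0 =
      a ^+ 2 + a + f.
    rewrite !hatD hat_sqr // hat_tsum low ?cards0 // add0r; congr (_ + _).
    by rewrite /hat /tau -mulr_suml -/(D set0 1) D0 mul1r.
  set psi := fun A => _ in al *.
  rewrite -[LHS](gr_sum g) big1 // => C _.
  rewrite gr_hat /hat (eq_bigl xpredT) => [|A]; last by rewrite sub0set.
  case: (eqVneq C set0) => [->|C0]; first by rewrite big1 // => A _; rewrite al eqxx.
  by apply: (sum_symd char2 _ C0) => A; rewrite [RHS]al (negPf C0).
have [||l' al' low'] := @frob_low k.+1 (l ++ [:: (1, a)]) rho; last 2 first.
- exact: low.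
- pose psi A := tsum l' A ^+ 2 + tsum l' A + rho A.
  have hpsi I : hat psi I = hatl l' I ^+ 2 + hatl l' I + hat rho I := hE I l'.
  have psi_low I : (#|I| < k.+1)%N -> hat psi I = 0.
    by move=> Ik; rewrite hpsi low // low' // expr0n /= !addr0.
  have SE I : S (hat rho I) I =
      S (hatl l' I ^+ 2 + hatl l' I) I + \sum_(C | C != set0) S (g C (hat psi I)) I.
    rewrite -S_sum -SD; congr (S _ I).
    have -> : \sum_(C | C != set0) g C (hat psi I) = hat psi I.
      have h0 : g set0 (hat psi I) = 0.
        by rewrite gr_hat /hat big1 // => A _; rewrite al' eqxx.
      by rewrite -[RHS](gr_sum g) [RHS](bigD1 set0) //= h0 add0r.
    by rewrite hpsi addrA addKK // add0r.
  under eq_bigr do rewrite SE.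
  rewrite big_split /= exchange_big /=; apply: ND; apply: N_sum.
    by move=> I /eqP Ik; apply: N_wp.
  by move=> C C0; apply: alt_exact.
have aE A : tsum [:: (1, a)] A = tau g (1, a) A by rewrite /tensor_of big_seq1.
apply: alt_eq (alt_add al (tau_frob char2 g 1 a)) => A.
rewrite /= tsum_cat aE -{1}hf sqrD // [1 * _]mul1r tauDr.
set u := tau g (1, a ^+ 2) A; set v := tau g (1, a) A; set w := tsum l A.
transitivity (w ^+ 2 + v ^+ 2 + (w + v) + rho A + (u + u)); first by ring.
by rewrite addKK // addr0.
Qed.

End GradedPiece.

(** * Finite extensions of a field containing the squares *)

Section Subfield.
Variables (F : fieldType) (P : pred F) (P_closed : divring_closed P).

HB.instance Definition _ := GRing.isDivringClosed.Build F P P_closed.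

Let subfield := {x | P x}.
HB.instance Definition _ := SubType.on subfield.
HB.instance Definition _ := Choice.on subfield.
HB.instance Definition _ := [SubChoice_isSubIntegralDomain of subfield by <:].
HB.instance Definition _ := [SubIntegralDomain_isSubField of subfield by <:].

Lemma subfield_exists : exists (K : fieldType) (v : {rmorphism K -> F}),
  forall x, P x <-> exists y, v y = x.
Proof.
exists subfield, (val : {rmorphism subfield -> F}) => x; split=> [Px|[y <-]].
  by exists (exist _ x Px).
exact: (valP y).
Qed.
End Subfield.

Section Frame.
Variables (F : fieldType) (char2 : 2%N \in [pchar F]) (E : F -> Prop).
Hypothesis E_add : forall x y, E x -> E y -> E (x + y).
Hypothesis E_mul : forall x y, E x -> E y -> E (x * y).
Hypothesis E_sqr : forall x, E (x ^+ 2).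

Lemma E0 : E 0. Proof. by have := E_sqr 0; rewrite expr0n. Qed.
Lemma E1 : E 1. Proof. by have := E_sqr 1; rewrite expr1n. Qed.

Section Monomials.
Variables (m : nat) (f : 'I_m -> F).
Implicit Types (A B C Z : {set 'I_m}) (x y : F).

Definition mono A : F := \prod_(i in A) f i.

Lemma monoM A B : mono A * mono B = mono (symd A B) * mono (A :&: B) ^+ 2.
Proof.
rewrite /mono (big_setID B) /= -mulrA [X in _ * X = _]mulrC.
rewrite [X in _ * (X * _) = _](big_setID A) /= (setIC B A) expr2 !mulrA.
rewrite -mulrA [RHS]mulrAC -[RHS]mulrA.
have -> : \prod_(i in symd A B) f i =
    (\prod_(i in A :\: B) f i) * \prod_(i in B :\: A) f i.
  rewrite (big_setID A) /=; congr (_ * _); apply: eq_bigl => i; rewrite !inE.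
    by case: (i \in A); case: (i \in B).
  by case: (i \in A); case: (i \in B).
by ring.
Qed.

(** The [f i] with [i] in [Z] are 2-independent over [E]. *)
Definition indep Z : bool := `[< forall e : {set 'I_m} -> F, (forall A, E (e A)) ->
  \sum_(A : {set 'I_m} | A \subset Z) e A * mono A = 0 ->
  forall A, A \subset Z -> e A = 0 >].

Definition spanE Z x := exists2 e : {set 'I_m} -> F, (forall A, E (e A)) &
  x = \sum_(A : {set 'I_m} | A \subset Z) e A * mono A.

Lemma spanE_mono Z A e : E e -> A \subset Z -> spanE Z (e * mono A).
Proof.
move=> Ee AZ; exists (fun B => if B == A then e else 0).
  by move=> B; case: ifP => // _; apply: E0.
rewrite (bigD1 A) //= eqxx big1 ?addr0 // => B /andP[_ /negPf ->].
by rewrite mul0r.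
Qed.

Lemma spanE_E Z e : E e -> spanE Z e.
Proof.
move=> Ee; have := spanE_mono Ee (sub0set Z).
by rewrite /mono big_set0 mulr1.
Qed.

Lemma spanE_add Z x y : spanE Z x -> spanE Z y -> spanE Z (x + y).
Proof.
move=> [e Ee ->] [e' Ee' ->]; exists (fun A => e A + e' A).
  by move=> A; apply: E_add.
by rewrite -big_split; apply: eq_bigr => A _; rewrite mulrDl.
Qed.

Lemma spanE_mul Z x y : spanE Z x -> spanE Z y -> spanE Z (x * y).
Proof.
have S0 : spanE Z 0 by apply: spanE_E; apply: E0.
move=> [e Ee ->] [e' Ee' ->]; rewrite mulr_suml.
apply: (big_ind (spanE Z)) => // [u w|A AZ]; first exact: spanE_add.
rewrite mulr_sumr; apply: (big_ind (spanE Z)) => // [u w|B BZ]; first exact: spanE_add.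
rewrite mulrACA monoM [mono _ * _]mulrC mulrA.
apply: spanE_mono; first by apply: E_mul => //; apply: E_mul.
apply/subsetP => i; rewrite in_symd; case: (boolP (i \in A)) => iA.
  by move=> _; apply: (subsetP AZ).
exact: (subsetP BZ).
Qed.

Lemma spanE_inv Z x : spanE Z x -> spanE Z x^-1.
Proof.
move=> Zx; have -> : x^-1 = x * x^-1 ^+ 2.
  have [->|x0] := eqVneq x 0; first by rewrite invr0 mul0r.
  by rewrite expr2 mulrA divff // mul1r.
by apply: spanE_mul => //; apply: spanE_E.
Qed.

Lemma spanE_closed Z : divring_closed (fun x => `[< spanE Z x >]).
Proof.
split=> [|x y /asboolP Zx /asboolP Zy|x y /asboolP Zx /asboolP Zy]; apply/asboolP.
- by apply: spanE_E; apply: E1.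
- by rewrite (oppr_pchar2 char2); apply: spanE_add.
- by apply: spanE_mul => //; apply: spanE_inv.
Qed.

Lemma indep_neq0 Z i : indep Z -> i \in Z -> f i != 0.
Proof.
move=> /asboolP iZ iZi; apply/eqP => fi0.
pose e (A : {set 'I_m}) : F := if A == [set i] then 1 else 0.
suff : e [set i] = 0 by rewrite /e eqxx => /eqP; rewrite oner_eq0.
apply: iZ; last by rewrite sub1set.
  by move=> A; rewrite /e; case: ifP => _; [apply: E1|apply: E0].
rewrite big1 // => A _; rewrite /e; case: eqP => [->|_]; last by rewrite mul0r.
by rewrite /mono big_set1 fi0 mulr0.
Qed.

(** A relation involving [f i] to the first power gives [f i] as a quotient [p / q]
    in the span of the monomials, which is a field. *)
Lemma maximal_span Z i : maxset indep Z -> spanE Z (f i).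
Proof.
move=> /maxsetP[iZ maxZ].
case: (boolP (i \in Z)) => iZi.
  have := @spanE_mono Z [set i] 1 E1; rewrite sub1set => /(_ iZi).
  by rewrite /mono big_set1 mul1r.
have : ~~ indep (i |: Z).
  by apply/negP => /maxZ/(_ (subsetUr _ _)) E'; move: iZi; rewrite -E' setU11.
move=> /asboolPn /existsNP[e /not_implyP[Ee /not_implyP[e0 /existsNP[A0 /not_implyP[A0Z eA0]]]]].
pose p := \sum_(A : {set 'I_m} | A \subset Z) e A * mono A.
pose q := \sum_(A : {set 'I_m} | A \subset Z) e (i |: A) * mono A.
have pq : p + q * f i = 0.
  rewrite -e0 [RHS](bigID (fun A : {set 'I_m} => i \in A)) /= addrC; congr (_ + _); last first.
    rewrite (reindex_onto (fun A => i |: A) (fun A => A :\ i)) /=; last first.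
      by move=> A /andP[_ iA]; rewrite setD1K.
    rewrite mulr_suml; apply: eq_big => [A|A AZ].
      rewrite setU11 andbT subUset sub1set setU11 /=.
      case: (boolP (i \in A)) => iA.
        rewrite (negPf (_ : ~~ (A \subset Z))); last first.
          by apply: contra iZi => /subsetP; apply.
        apply/esym/negP => /andP[_ /eqP /setP /(_ i)].
        by rewrite !inE eqxx iA.
      rewrite setU1K // eqxx andbT; apply/idP/idP => sub.
        exact: subset_trans sub (subsetUr _ _).
      apply/subsetP => j jA; have := subsetP sub j jA; rewrite !inE.
      by case: eqP => // ji; rewrite -ji jA in iA.
    rewrite /mono big_setU1 /=; first by ring.
    by apply: contra iZi => /(subsetP AZ).
  apply: eq_bigl => A; apply/idP/andP => [AZ|[sub iA]].
    split; first exact: subset_trans AZ (subsetUr _ _).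
    by apply: contra iZi => /(subsetP AZ).
  apply/subsetP => j jA; have := subsetP sub j jA; rewrite !inE.
  by case: eqP => // ji; rewrite -ji jA in iA.
have q0 : q != 0.
  apply/eqP => q0; have p0 : p = 0 by rewrite -pq q0 mul0r addr0.
  move/asboolP: iZ => iZ; apply: eA0.
  case: (boolP (i \in A0)) => iA0.
    have := iZ (fun A => e (i |: A)) (fun A => Ee _) q0 (A0 :\ i).
    rewrite setD1K //; apply; apply/subsetP => j; rewrite in_setD1 => /andP[ji jA].
    by have := subsetP A0Z j jA; rewrite !inE (negPf ji).
  apply: (iZ e Ee p0); apply/subsetP => j jA; have := subsetP A0Z j jA; rewrite !inE.
  by case: eqP => // ji; rewrite -ji jA in iA0.
have -> : f i = p / q.
  by apply: (mulIf q0); rewrite mulfVK // mulrC (eq_addr0 char2 pq).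
apply: spanE_mul; first by exists e.
by apply: spanE_inv; exists (fun A => e (i |: A)).
Qed.

Lemma max_indep : exists Z, maxset indep Z.
Proof.
have i0 : indep set0.
  apply/asboolP => e _; rewrite (big_pred1 set0) => [|A]; last by rewrite subset0.
  by rewrite /mono big_set0 mulr1 => e0 A; rewrite subset0 => /eqP ->.
by have [Z mZ _] := maxset_exists i0; exists Z.
Qed.

End Monomials.

(** A maximal 2-independent subfamily of [L] is a 2-basis of [E(L)] over [E]. The
    grading is indexed by subsets of the whole index set of [L], with zero
    components at the subsets not contained in the 2-basis, and [b] is 1 outside
    the 2-basis. *)
Lemma frame_exists (L : seq F) :
  exists (K : fieldType) (v : {rmorphism K -> F}) (m : nat) (g : grading K 'I_m)
    (b : 'I_m -> K),
  [/\ forall x, x \in L -> exists y, v y = x,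
      forall x, E x -> exists2 y, v y = x & g set0 y = y,
      forall (A : {set 'I_m}) x i, i \in A -> g A x != 0 -> generator g b i,
      forall i, b i != 0 &
      forall (A : {set 'I_m}) x,
        exists2 e, E e & v (g A x) = e * \prod_(i in A) v (b i)].
Proof.
pose m := size L; pose f (i : 'I_m) := L`_i.
have [Z mZ] := max_indep f.
have /maxsetP[iZ _] := mZ; move/asboolP: (iZ) => Z_free.
have [K [v vP]] := subfield_exists (spanE_closed f Z).
have KP x : spanE f Z x -> exists y, v y = x by move/asboolP/vP.
have KE y : spanE f Z (v y) by apply/asboolP/vP; exists y.
pose hom (A : {set 'I_m}) (z : K) :=
  (exists2 e, E e & v z = e * mono f A) /\ (A \subset Z \/ z = 0).
have /choice[gf gfP] (y : K) : exists h : {set 'I_m} -> K,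
    (forall A, hom A (h A)) /\ \sum_A h A = y.
  have [e Ee ye] := KE y.
  have /choice[h hP] (A : {set 'I_m}) : exists z : K, v z = if A \subset Z then e A * mono f A else 0.
    case: ifP => AZ; last by exists 0; rewrite rmorph0.
    by apply: KP; apply: spanE_mono.
  exists h; split=> [A|].
    split.
      rewrite hP; case: ifP => AZ; first by exists (e A).
      by exists 0; [exact: E0|rewrite mul0r].
    case: (boolP (A \subset Z)) => AZ; [by left|right].
    by apply: (fmorph_inj v); rewrite hP (negPf AZ) rmorph0.
  apply: (fmorph_inj v); rewrite rmorph_sum ye /= [RHS]big_mkcond.
  by apply: eq_bigr => A _; rewrite hP.
have homD A x y : hom A x -> hom A y -> hom A (x + y).
  move=> [[e Ee xe] hx] [[e' Ee' ye] hy]; split.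
    by exists (e + e'); [exact: E_add|rewrite rmorphD xe ye mulrDl].
  case: hx => [|->]; first by left.
  by rewrite add0r; case: hy; [left|right].
have hom0 (A : {set 'I_m}) : hom A 0.
  by split; [exists 0; [exact: E0|rewrite rmorph0 mul0r]|right].
have uniq h h' : (forall A, hom A (h A)) -> (forall A, hom A (h' A)) ->
    \sum_A h A = \sum_A h' A -> forall A, h A = h' A.
  move=> hh hh' hs A.
  have hd B : hom B (h B + h' B) by apply: homD.
  have /choice[e /all_and2[Ee eP]] B : exists e, E e /\ v (h B + h' B) = e * mono f B.
    by have [[e Ee eE] _] := hd B; exists e.
  have vchar : 2%N \in [pchar K] by rewrite -(fmorph_pchar v).
  apply: (eq_addr0 vchar); apply: (fmorph_inj v); rewrite rmorph0.
  case: (hd A) => _ [AZ|->]; last by rewrite rmorph0.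
  have s0 : \sum_B v (h B + h' B) = 0.
    by rewrite -rmorph_sum big_split /= hs addKK // rmorph0.
  rewrite eP (Z_free e) ?mul0r // -[RHS]s0 big_mkcond /=; apply: eq_bigr => B _.
  case: ifP => BZ; first by rewrite eP.
  by case: (hd B) => _ [|->]; [rewrite BZ|rewrite rmorph0].
have char : forall y h, (forall A, hom A (h A)) -> \sum_A h A = y ->
    forall A, gf y A = h A.
  move=> y h hh hs; apply: uniq => //; first by case: (gfP y).
  by have [_ ->] := gfP y.
have gh y A : hom A (gf y A) by case: (gfP y).
have gs y : \sum_A gf y A = y by case: (gfP y).
pose gA (A : {set 'I_m}) y := gf y A.
have gD A : {morph gA A : x y / x + y}.
  move=> x y; apply: (char _ (fun A => gf x A + gf y A)) => [B|]; first exact: homD.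
  by rewrite big_split /= !gs.
have one A z : hom A z -> forall B, gA B z = if B == A then z else 0.
  move=> hz; apply: char => [B|]; first by case: eqP => [->|_].
  rewrite (bigD1 A) //= eqxx big1 ?addr0 // => B /negPf -> //.
have gg A B x : gA A (gA B x) = if A == B then gA A x else 0.
  rewrite (one B) //; last exact: gh.
  by case: eqP => [->|].
have homM A B x y : hom A x -> hom B y -> hom (symd A B) (x * y).
  move=> [[e Ee xe] hx] [[e' Ee' ye] hy]; split.
    exists (e * e' * mono f (A :&: B) ^+ 2); first by apply: E_mul => //; apply: E_mul.
    by rewrite rmorphM xe ye mulrACA monoM; ring.
  case: hx => [AZ|->]; last by right; rewrite mul0r.
  case: hy => [BZ|->]; last by right; rewrite mulr0.
  left; apply/subsetP => i; rewrite in_symd; case: (boolP (i \in A)) => iA.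
    by move=> _; apply: (subsetP AZ).
  exact: (subsetP BZ).
have gM C x y : gA C (x * y) = \sum_A gA A x * gA (symd A C) y.
  apply: (char _ (fun C => \sum_A gA A x * gA (symd A C) y)) => [B|].
    apply: (big_ind (hom B)) => // [u w|A _]; first exact: homD.
    by rewrite -[B in hom B](symdK A); apply: homM; apply: gh.
  rewrite exchange_big /= -{2}(gs x) mulr_suml; apply: eq_bigr => A _.
  rewrite -mulr_sumr; congr (_ * _).
  by rewrite -[RHS](gs y) [RHS](reindex_inj (inv_inj (symdK A))).
pose g := Grading gD gs gg gM.
have /choice[fK fKP] i : exists y, v y = f i by apply: KP; apply: maximal_span.
pose b i := if i \in Z then fK i else 1.
have b0 i : b i != 0.
  rewrite /b; case: ifP => iZi; last exact: oner_neq0.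
  by rewrite -(fmorph_eq0 v) fKP; apply: indep_neq0 iZi.
have gZ (A : {set 'I_m}) x : ~~ (A \subset Z) -> gA A x = 0.
  by move=> AZ; case: (gh x A) => _ [] //; rewrite (negPf AZ).
exists K, v, m, g, b; split=> //.
- move=> x xL; have lt : (index x L < m)%N by rewrite index_mem.
  by exists (fK (Ordinal lt)); rewrite fKP /f /= nth_index.
- move=> x Ex; have [y yx] := KP _ (spanE_E f Z Ex); exists y => //.
  rewrite -[LHS]/(gA set0 y) (one set0) ?eqxx //; split.
    by exists x; rewrite // yx /mono big_set0 mulr1.
  by left; apply: sub0set.
- move=> A x i iA gx; have AZ : A \subset Z.
    by apply: contraR gx => AZ; rewrite -[g A x]/(gA A x) gZ.
  have iZi := subsetP AZ i iA; split; first exact: b0.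
  rewrite -[LHS]/(gA [set i] (b i)) (one [set i]) ?eqxx // /b iZi; split.
    by exists 1; [exact: E1|rewrite fKP /mono big_set1 mul1r].
  by left; rewrite sub1set.
- move=> A x; case: (gh x A) => [[e Ee ge] [AZ|g0]]; last first.
    by exists 0; [exact: E0|rewrite -[g A x]/(gf x A) g0 rmorph0 mul0r].
  exists e => //; rewrite [LHS]ge; congr (_ * _); apply: eq_bigr => i iA.
  by rewrite /b (subsetP AZ i iA) fKP.
Qed.

End Frame.

(** * Differential forms *)

Section LeftWedge.
Variable F : fieldType.
Implicit Types (x y : Omega1 F) (k : nat).

Lemma lwedge_exists k x : exists h : {additive Omega F k -> Omega F k.+1},
  forall c t, h (c *: wedge t) = c *: wedge (fcons x t).
Proof.
apply: extpow_lift => [a c t|c t i a y z|c t i j ij tij].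
- exact: scalerDl.
- by rewrite !fcons_upd wedge_lin scalerDr scalerA.
- have ij' : fintype.lift ord0 i != fintype.lift ord0 j by rewrite (inj_eq lift_inj).
  by rewrite (wedge_alt ij') ?scaler0 // !ffunE !liftK /= tij.
Qed.

Definition lwedge k x : {additive Omega F k -> Omega F k.+1} :=
  sval (cid (lwedge_exists k x)).

Lemma lwedgeE k x c (t : {ffun 'I_k -> Omega1 F}) :
  lwedge k x (c *: wedge t) = c *: wedge (fcons x t).
Proof. exact: (svalP (cid (lwedge_exists k x))). Qed.

Lemma lwedge1 k x (t : {ffun 'I_k -> Omega1 F}) : lwedge k x (wedge t) = wedge (fcons x t).
Proof. by rewrite -[wedge t]scale1r lwedgeE scale1r. Qed.

Lemma lwedgeZ k x a (w : Omega F k) : lwedge k x (a *: w) = a *: lwedge k x w.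
Proof.
elim/extpow_ind: w => [u v Hu Hv|c t|]; last by rewrite scaler0 !raddf0 ?scaler0.
  by rewrite scalerDr !raddfD /= Hu Hv.
by rewrite scalerA !lwedgeE scalerA.
Qed.

Lemma lwedge_lin k a x y (w : Omega F k) :
  lwedge k (a *: x + y) w = a *: lwedge k x w + lwedge k y w.
Proof.
elim/extpow_ind: w => [u v Hu Hv|c t|]; last by rewrite !raddf0 ?scaler0 ?addr0.
  by rewrite !raddfD /= Hu Hv addrACA.
rewrite !lwedgeE; have E z := fcons0 z 0 t; rewrite (E (_ + _)) wedge_lin -!E.
by rewrite scalerDr !scalerA [a * c]mulrC.
Qed.

Lemma lwedgeDx k x y (w : Omega F k) : lwedge k (x + y) w = lwedge k x w + lwedge k y w.
Proof. by rewrite -[x in LHS]scale1r lwedge_lin scale1r. Qed.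

Lemma lwedge0x k (w : Omega F k) : lwedge k 0 w = 0.
Proof. by apply: (addrI (lwedge k 0 w)); rewrite -lwedgeDx !addr0. Qed.

Lemma lwedgeZx k a x (w : Omega F k) : lwedge k (a *: x) w = a *: lwedge k x w.
Proof. by rewrite -[a *: x]addr0 lwedge_lin lwedge0x addr0. Qed.

Lemma lwedge_sumx k (J : Type) (r : seq J) (P : pred J) (f : J -> Omega1 F) (w : Omega F k) :
  lwedge k (\sum_(j <- r | P j) f j) w = \sum_(j <- r | P j) lwedge k (f j) w.
Proof.
by apply: (big_morph (fun x => lwedge k x w)) => [x y|]; rewrite ?lwedgeDx ?lwedge0x.
Qed.

Lemma lwedge_sqr k x (w : Omega F k) : lwedge k.+1 x (lwedge k x w) = 0.
Proof.
elim/extpow_ind: w => [u v Hu Hv|c t|]; last by rewrite !raddf0.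
  by rewrite !raddfD /= Hu Hv addr0.
rewrite !lwedgeE (@wedge_alt _ _ _ _ ord0 (fintype.lift ord0 ord0)) ?scaler0 //.
by rewrite !ffunE unlift_none liftK /= ffunE unlift_none.
Qed.

Lemma lwedge_anti k x y (w : Omega F k) :
  lwedge k.+1 x (lwedge k y w) + lwedge k.+1 y (lwedge k x w) = 0.
Proof.
have := lwedge_sqr (x + y) w.
by rewrite !lwedgeDx !raddfD /= !lwedge_sqr add0r addr0.
Qed.

(** Products of sequences, which can be permuted and split more easily than the
    families indexed by ordinals. *)
Fixpoint wedges k (s : seq (Omega1 F)) : Omega F k :=
  match k with
  | 0 => wedge [ffun i : 'I_0 => 0]
  | k'.+1 => if s is x :: s' then lwedge k' x (wedges k' s') else 0
  end.

Lemma wedges_ffun k (t : {ffun 'I_k -> Omega1 F}) :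
  wedge t = wedges k [seq t i | i <- enum 'I_k].
Proof.
elim: k t => [|k IH] t /=; first by congr wedge; apply/ffunP => -[].
rewrite -{1}(fcons_behead t) enum_ordSl /= -map_comp -lwedge1 IH.
by congr (lwedge _ _ (wedges _ _)); apply: eq_map => i; rewrite ffunE.
Qed.

Lemma wedges_nth k (s : seq (Omega1 F)) : size s = k ->
  wedges k s = wedge [ffun i : 'I_k => s`_i].
Proof.
move=> sk; rewrite wedges_ffun; congr wedges; apply: (@eq_from_nth _ 0).
  by rewrite size_map size_enum_ord.
move=> i; rewrite sk => ik; rewrite (nth_map (Ordinal ik)) ?size_enum_ord //.
by rewrite ffunE nth_enum_ord.
Qed.

Section Symmetry.
Hypothesis char2 : 2%N \in [pchar F].

Lemma Omega_addKK k (w : Omega F k) : w + w = 0.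
Proof. by rewrite -[w]scale1r -scalerDl addKK // scale0r. Qed.

Lemma Omega_eq k (w z : Omega F k) : w + z = 0 -> w = z.
Proof. by move=> wz; rewrite -[w]addr0 -(Omega_addKK z) addrA wz add0r. Qed.

Lemma lwedgeC k x y (w : Omega F k) :
  lwedge k.+1 x (lwedge k y w) = lwedge k.+1 y (lwedge k x w).
Proof. exact: Omega_eq (lwedge_anti x y w). Qed.

Lemma wedges_mid k s1 x s2 : (size s1 < k)%N ->
  wedges k (s1 ++ x :: s2) = wedges k (x :: s1 ++ s2).
Proof.
elim: k s1 => [|k IH] [|y s1] //=; rewrite ltnS => sk.
by rewrite IH //; case: k sk {IH} => // k _; apply: lwedgeC.
Qed.

Lemma wedges_perm k s1 s2 : size s1 = k -> perm_eq s1 s2 -> wedges k s1 = wedges k s2.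
Proof.
elim: s1 k s2 => [|x s1 IH] k s2 sk; first by move/perm_size; case: s2.
move=> p12; have xs2 : x \in s2 by rewrite -(perm_mem p12) mem_head.
move: p12 (perm_size p12); case/splitPr: xs2 => u w p12 sz.
rewrite wedges_mid; last by rewrite -sk sz size_cat /= addnS ltnS leq_addr.
case: k sk => [//|k] [sk] /=; congr (lwedge _ _ _); apply: IH => //.
by rewrite -(perm_cons x) (permPl p12) perm_catC /= perm_cons perm_catC.
Qed.

Lemma wedges_dup k x s : size s = k -> x \in s -> lwedge k x (wedges k s) = 0.
Proof.
move=> sk xs; move: sk; case/splitPr: xs => u w sk.
rewrite wedges_mid; last by rewrite -sk size_cat /= addnS ltnS leq_addr.
by case: k sk => [|k _] /=; [rewrite size_cat addnS|exact: lwedge_sqr].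
Qed.

End Symmetry.
End LeftWedge.

Section Classes.
Variables (F : fieldType) (char2 : 2%N \in [pchar F]).
Implicit Types (k : nat) (a c x : F).

Definition kmc k (w : Omega F k) : kato_milne char2 k.+1 :=
  kato_milne_class char2 (n := k.+1) w.

Lemma kmcD k (w z : Omega F k) : kmc (w + z) = kmc w + kmc z.
Proof. by rewrite /kmc raddfD. Qed.

Lemma kmc0 k : kmc (0 : Omega F k) = 0.
Proof. by rewrite /kmc raddf0. Qed.

Lemma kmc_sum k (J : Type) (r : seq J) (P : pred J) (f : J -> Omega F k) :
  kmc (\sum_(j <- r | P j) f j) = \sum_(j <- r | P j) kmc (f j).
Proof. by rewrite /kmc raddf_sum. Qed.

Lemma kmc_exact k (w : Omega F k) : mod_exact w = 0 -> kmc w = 0.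
Proof.
by move=> w0; rewrite /kmc /kato_milne_class w0 raddf0.
Qed.

Lemma kmc_eq0 k (w : Omega F k) :
  kmc w = 0 <-> exists u, artin_schreier char2 k u = mod_exact w.
Proof.
have -> : (kmc w = 0) <-> as_image char2 (mod_exact w - mod_exact 0).
  rewrite -(kmc0 k) /kmc /kato_milne_class; split=> [/eqP|h].
    by rewrite -Quotient.idealrBE.
  by apply/eqP; rewrite -Quotient.idealrBE.
by rewrite raddf0 subr0; split=> [/asboolP|h]; [|apply/asboolP].
Qed.

Lemma kmc_wp k a (t : {ffun 'I_k -> F}) : (forall i, t i != 0) ->
  kmc (dlog_form (a ^+ 2 - a) t) = 0.
Proof. by move=> t0; apply/kmc_eq0; exists (dlog_form a t); apply: artin_schreierE. Qed.

Lemma dlog0 : dlog (0 : F) = 0.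
Proof. by rewrite /dlog invr0 scale0r. Qed.

Lemma dlogE c : c *: dlog c = kdiff c.
Proof.
have [->|c0] := eqVneq c 0; last by rewrite /dlog scalerA divff // scale1r.
rewrite scale0r; apply: (addrI (kdiff 0)).
by rewrite -kdiffD !addr0.
Qed.

Lemma kdiff_sqr x : kdiff (x ^+ 2) = 0.
Proof. by rewrite expr2 kdiffM -scalerDl addKK // scale0r. Qed.

Lemma lwedge_dwedge k x (t : {ffun 'I_k -> F}) :
  lwedge k (kdiff x) (dwedge t) = dwedge (fcons x t).
Proof.
rewrite lwedge1; congr wedge; apply/ffunP => i; rewrite !ffunE.
by case: (unliftP ord0 i) => [j _|_] /=; rewrite ?ffunE.
Qed.

Lemma lwedge_dlog_form k a c (t : {ffun 'I_k -> F}) :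
  lwedge k (dlog c) (dlog_form a t) = dlog_form a (fcons c t).
Proof.
rewrite /dlog_form lwedgeE; congr (_ *: wedge _); apply/ffunP => i; rewrite !ffunE.
by case: (unliftP ord0 i) => [j _|_] /=; rewrite ?ffunE.
Qed.

Lemma fcons_neq0 k c (t : {ffun 'I_k -> F}) : c != 0 -> (forall i, t i != 0) ->
  forall i, fcons c t i != 0.
Proof. by move=> c0 t0 i; rewrite ffunE; case: (unliftP ord0 i) => [j _|_] /=. Qed.

(** [dlog c /\ da /\ dt] is the differential of [(a / c) dc /\ dt]. *)
Lemma dlog_exact k c a (t : {ffun 'I_k -> F}) :
  mod_exact (lwedge k.+1 (dlog c) (dwedge (fcons a t))) = 0.
Proof.
have [->|c0] := eqVneq c 0; first by rewrite dlog0 lwedge0x raddf0.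
rewrite -(@mod_exact_dwedge _ _ (fcons (a / c) (fcons c t))); congr mod_exact.
rewrite -!lwedge_dwedge kdiffM lwedgeDx !lwedgeZx [kdiff c^-1](_ : _ = c^-1 ^+ 2 *: kdiff c).
  by rewrite lwedgeZx lwedge_sqr !scaler0 add0r [in LHS]lwedgeC.
have : kdiff (c^-1 ^+ 2 * c) = c^-1 ^+ 2 *: kdiff c.
  by rewrite kdiffM kdiff_sqr scaler0 addr0.
by rewrite expr2 -mulrA mulVf // mulr1.
Qed.

(** [dlog c /\ _] maps exact forms to exact forms and commutes with the
    Artin-Schreier map. *)
Lemma kmc_lwedge k c (w : Omega F k) : kmc w = 0 -> kmc (lwedge k (dlog c) w) = 0.
Proof.
move=> /kmc_eq0[u uw].
have [->|c0] := eqVneq c 0; first by rewrite dlog0 lwedge0x kmc0.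
have [r [e [he ue]]] := Omega_decomposable u.
have /choice[a aP] i : exists a, exists2 t : {ffun 'I_k -> F}, (forall j, t j != 0) &
    e i = dlog_form a t.
  by have [a [t [t0 et]]] := he i; exists a, t.
have /choice[t /all_and2[t0 et]] i : exists t : {ffun 'I_k -> F},
    (forall j, t j != 0) /\ e i = dlog_form (a i) t.
  by have [t t0 et] := aP i; exists t.
pose z := \sum_i dlog_form (a i ^+ 2 - a i) (t i).
have uz : artin_schreier char2 k u = mod_exact z.
  rewrite ue !raddf_sum /=; apply: eq_bigr => i _.
  by rewrite et artin_schreierE.
have zE : kmc (lwedge k (dlog c) z) = 0.
  rewrite raddf_sum kmc_sum big1 // => i _ /=.
  rewrite lwedge_dlog_form kmc_wp //; exact: fcons_neq0.
have : exact_form (w - z) by rewrite -mod_exact_eq -uw uz.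
rewrite -[w](subrK z) raddfD kmcD /= zE addr0 addrK.
move: (w - z) => y; case: k y {w u uw e he ue a aP t t0 et z uz zE} => [|k] y /=.
  by move/eqP ->; rewrite raddf0 kmc0.
move/asboolP => [v <-]; elim/Omega_gen: v => [|v1 v2 h1 h2|a t].
- by rewrite !raddf0 kmc0.
- by rewrite !raddfD kmcD /= h1 h2 addr0.
- by rewrite ediffE; apply/kmc_exact/dlog_exact.
Qed.

(** [dz /\ dlog b_1 /\ ... /\ dlog b_k] is the differential of
    [z dlog b_1 /\ ... /\ dlog b_k]. *)
Lemma kmc_kdiff k z (t : {ffun 'I_k -> F}) : (forall i, t i != 0) ->
  kmc (lwedge k (kdiff z) (dlog_form 1 t)) = 0.
Proof.
move=> t0; apply: kmc_exact.
rewrite dlog_formE mul1r lwedgeZ lwedge_dwedge.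
rewrite -(@dwedge_exact _ char2 _ (fcons z t) ord0 (\prod_i (t i)^-1) z).
congr (mod_exact (_ *: dwedge _)); last first.
  by rewrite -[in RHS](fcons0 z z t).
have -> : \prod_(j | j != ord0) fcons z t j = \prod_i t i.
  rewrite big_mkcond big_ord_recl eqxx /= mul1r; apply: eq_bigr => i _.
  by rewrite ffunE liftK.
rewrite expr2 -mulrA -big_split /= [X in _ * X]big1 ?mulr1 // => i _.
exact: mulVf.
Qed.

End Classes.

Section RelativeForms.
Variables (F : fieldType) (char2 : 2%N \in [pchar F]).
Variables (N : nat) (c : 'I_N -> F).
Implicit Types (k : nat) (a x : F).

Definition in_ideal k : Omega F k -> Prop :=
  match k with
  | 0 => fun w => w = 0
  | k'.+1 => fun w => exists h : 'I_N -> Omega F k', w = \sum_j lwedge k' (dlog (c j)) (h j)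
  end.

Lemma in_ideal0 k : @in_ideal k 0.
Proof.
by case: k => //= k; exists (fun=> 0); rewrite big1 // => j _; rewrite raddf0.
Qed.

Lemma in_idealD k (w z : Omega F k) : in_ideal w -> in_ideal z -> in_ideal (w + z).
Proof.
case: k w z => [|k] w z /= => [->->|[h ->] [h' ->]]; first exact: addr0.
exists (fun j => h j + h' j); rewrite -big_split.
by apply: eq_bigr => j _; rewrite raddfD.
Qed.

Lemma in_idealZ k a (w : Omega F k) : in_ideal w -> in_ideal (a *: w).
Proof.
case: k w => [|k] w /= => [->|[h ->]]; first exact: scaler0.
exists (fun j => a *: h j); rewrite scaler_sumr.
by apply: eq_bigr => j _; rewrite lwedgeZ.
Qed.

Lemma in_ideal_lwedge k (x : Omega1 F) (w : Omega F k) : in_ideal w -> in_ideal (lwedge k x w).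
Proof.
case: k w => [|k] w => [->|[h ->]]; first by rewrite raddf0; apply: in_ideal0.
exists (fun j => lwedge k x (h j)); rewrite raddf_sum.
by apply: eq_bigr => j _ /=; rewrite lwedgeC.
Qed.

(** The constants for the differential forms relative to the [c j]; they form a
    field that contains the squares and the [c j]. *)
Definition constant a : Prop :=
  exists h : 'I_N -> F, kdiff a = \sum_j h j *: dlog (c j).

Lemma constantD a a' : constant a -> constant a' -> constant (a + a').
Proof.
move=> [h ha] [h' ha']; exists (fun j => h j + h' j).
rewrite kdiffD ha ha' -big_split; apply: eq_bigr => j _; exact/esym/scalerDl.
Qed.

Lemma constantM a a' : constant a -> constant a' -> constant (a * a').
Proof.
move=> [h ha] [h' ha']; exists (fun j => a * h' j + a' * h j).
rewrite kdiffM ha ha' !scaler_sumr -big_split; apply: eq_bigr => j _.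
by rewrite scalerDl !scalerA.
Qed.

Lemma constant_sqr a : constant (a ^+ 2).
Proof.
exists (fun=> 0); rewrite kdiff_sqr // big1 // => j _; exact: scale0r.
Qed.

Lemma constant_c j : constant (c j).
Proof.
exists (fun i => if i == j then c j else 0); rewrite -dlogE (bigD1 j) //= eqxx.
by rewrite big1 ?addr0 // => i /negPf ->; rewrite scale0r.
Qed.

Lemma in_ideal_constant k a (w : Omega F k) : constant a -> in_ideal (lwedge k (kdiff a) w).
Proof.
move=> [h ->]; exists (fun j => h j *: w); rewrite lwedge_sumx.
by apply: eq_bigr => j _; rewrite lwedgeZx lwedgeZ.
Qed.

Variables (K : fieldType) (v : {rmorphism K -> F}) (m : nat) (g : grading K 'I_m).
Variable b : 'I_m -> K.
Hypothesis b0 : forall i, b i != 0.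
Hypothesis gE : forall (A : {set 'I_m}) y,
  exists2 e, constant e & v (g A y) = e * \prod_(i in A) v (b i).
Implicit Types (A I J : {set 'I_m}) (y : K).

Let bb i : Omega1 F := dlog (v (b i)).

Let K_char2 : 2%N \in [pchar K]. Proof. by rewrite -(fmorph_pchar v). Qed.

Lemma kdiff_prod (A : {set 'I_m}) :
  kdiff (\prod_(i in A) v (b i)) = \sum_(i in A) (\prod_(i in A) v (b i)) *: bb i.
Proof.
rewrite -scaler_sumr; apply: (big_rec2 (fun s p => kdiff p = p *: s)) => [|i s p _ IH].
  by rewrite scaler0; have := kdiff_sqr char2 1; rewrite expr1n.
rewrite kdiffM IH scalerDr !scalerA addrC; congr (_ + _).
by rewrite [_ * p]mulrC mulfK ?fmorph_eq0.
Qed.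

Lemma kdiff_homog A y k (w : Omega F k) :
  in_ideal (lwedge k (kdiff (v (g A y))) w + \sum_(i in A) v (g A y) *: lwedge k (bb i) w).
Proof.
have [e ce ->] := gE A y.
rewrite kdiffM kdiff_prod lwedgeDx [_ + lwedge _ _ w]addrC -addrA.
apply: in_idealD; first by rewrite lwedgeZx; apply/in_idealZ/in_ideal_constant.
rewrite lwedgeZx lwedge_sumx scaler_sumr.
rewrite (eq_bigr (fun i => (e * \prod_(i in A) v (b i)) *: lwedge k (bb i) w)).
  by rewrite Omega_addKK //; apply: in_ideal0.
by move=> i _; rewrite lwedgeZx scalerA.
Qed.

(** The operator [pderiv g [set i]] is [b_i] times the partial derivative along [b_i],
    so this is the formula for the total differential. *)
Lemma kdiff_total y k (w : Omega F k) :
  in_ideal (lwedge k (kdiff (v y)) w +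
            \sum_i v (pderiv g [set i] y) *: lwedge k (bb i) w).
Proof.
have -> : \sum_i v (pderiv g [set i] y) *: lwedge k (bb i) w =
    \sum_(A : {set 'I_m}) \sum_(i in A) v (g A y) *: lwedge k (bb i) w.
  rewrite (exchange_big_dep xpredT) //=; apply: eq_bigr => i _.
  rewrite /pderiv rmorph_sum scaler_suml; apply: eq_bigl => A.
  by rewrite sub1set.
have -> : lwedge k (kdiff (v y)) w = \sum_A lwedge k (kdiff (v (g A y))) w.
  rewrite -lwedge_sumx; congr (lwedge _ _ w).
  rewrite -[in LHS](gr_sum g y) rmorph_sum /=.
  apply: (big_morph (@kdiff F) (@kdiffD F)).
  by rewrite -(dlogE 0) scale0r.
rewrite -big_split; apply: (big_ind (@in_ideal k.+1)) => [|w1 w2|A _].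
- exact: in_ideal0.
- exact: in_idealD.
- exact: kdiff_homog.
Qed.

Definition basis_form k I : Omega F k := wedges k [seq bb i | i <- enum I].

Lemma basis_formS k I i : #|I| = k ->
  lwedge k (bb i) (basis_form k I) = if i \in I then 0 else basis_form k.+1 (i |: I).
Proof.
move=> Ik; have sI : size [seq bb i | i <- enum I] = k by rewrite size_map -cardE.
case: ifP => iI.
  by apply: (wedges_dup char2) => //; apply: map_f; rewrite mem_enum.
rewrite -[LHS]/(wedges k.+1 (bb i :: [seq bb i | i <- enum I])).
rewrite -map_cons; apply: (wedges_perm char2); rewrite ?size_map /=.
  by rewrite -Ik cardE.
rewrite -/([seq bb j | j <- i :: enum I]); apply: perm_map; apply: uniq_perm; rewrite /= ?enum_uniq ?mem_enum ?iI //.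
by move=> j; rewrite !inE !mem_enum !inE.
Qed.

Lemma basis_form_dlog k I : #|I| = k -> exists2 t : {ffun 'I_k -> F},
  (forall i, t i != 0) & forall a, a *: basis_form k I = dlog_form a t.
Proof.
move=> Ik; exists [ffun i : 'I_k => nth 1 [seq v (b i) | i <- enum I] i].
  move=> i; rewrite ffunE.
  have sI : (i < size [seq v (b i) | i <- enum I])%N by rewrite size_map -cardE Ik.
  have /mapP[j _ ->] := mem_nth 1 sI.
  by rewrite fmorph_eq0.
move=> a; rewrite /dlog_form /basis_form wedges_nth ?size_map -?cardE //.
congr (_ *: wedge _); apply/ffunP => i; rewrite !ffunE.
have sI : (i < size [seq v (b i) | i <- enum I])%N by rewrite size_map -cardE Ik.
rewrite -(nth_map 1 (0 : Omega1 F) (@dlog F) sI) -map_comp.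
by [].
Qed.

Definition leading k (l : seq (K * K)) : Omega F k :=
  \sum_(I : {set 'I_m} | #|I| == k) v (hat_list g l I) *: basis_form k I.

(** Each slot multiplies the tensor by [y (x) y^-1 - 1], whose leading form is
    [dlog y] modulo the ideal. *)
Lemma leading_pf alpha ys : all (fun y => y != 0) ys ->
  in_ideal (leading (size ys) (pfister alpha ys) +
            v alpha *: wedges (size ys) [seq dlog (v y) | y <- ys]).
Proof.
elim: ys => [|y ys IH] /= => [_|/andP[y0 ys0]].
  rewrite /leading (big_pred1 set0) => [|I]; last by rewrite cards_eq0.
  rewrite /hat_list big_seq1 /= (D1 K_char2) eqxx mul1r.
  by rewrite /basis_form /= Omega_addKK.
set k := size ys in IH *; set w := wedges k _ in IH *.
have leadE : leading k.+1 (pfister alpha (y :: ys)) =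
    \sum_i v (dlog_coef g i y) *: lwedge k (bb i) (leading k (pfister alpha ys)).
  transitivity (\sum_(I : {set 'I_m} | #|I| == k.+1) \sum_(i in I)
      (v (dlog_coef g i y) * v (hat_list g (pfister alpha ys) (I :\ i))) *: basis_form k.+1 I).
    apply: eq_bigr => I /eqP Ik; rewrite (pf_lead K_char2) // rmorph_sum scaler_suml.
    by apply: eq_bigr => i _; rewrite rmorphM.
  rewrite (exchange_big_dep xpredT) //=; apply: eq_bigr => i _.
  rewrite raddf_sum scaler_sumr /=.
  rewrite [RHS](bigID (fun J : {set 'I_m} => i \in J)) /= [X in X + _]big1 ?add0r; last first.
    by move=> J /andP[/eqP Jk iJ]; rewrite lwedgeZ basis_formS // iJ !scaler0.
  rewrite (reindex_onto (fun J => i |: J) (fun I => I :\ i)) /=; last first.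
    by move=> I /andP[_ iI]; rewrite setD1K.
  apply: eq_big => [J|J /andP[/andP[/eqP Jk _] /eqP JE]].
    rewrite setU11 andbT; case: (boolP (i \in J)) => iJ /=.
      rewrite andbF; apply/negP => /andP[_ /eqP /setP /(_ i)].
      by rewrite !inE eqxx iJ.
    by rewrite setU1K // eqxx !andbT cardsU1 iJ.
  have iJ : i \notin J by rewrite -JE !inE eqxx.
  move: Jk; rewrite cardsU1 iJ => -[Jk].
  by rewrite JE lwedgeZ basis_formS // (negPf iJ) scalerA.
rewrite leadE -lwedgeZ.
set u := leading k (pfister alpha ys) in IH *; set p := lwedge k (dlog (v y)).
have -> : v alpha *: w = u + (u + v alpha *: w) by rewrite addrA Omega_addKK ?add0r.
change (@in_ideal k.+1 (\sum_i v (dlog_coef g i y) *: lwedge k (bb i) u +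
  p (u + (u + v alpha *: w)))).
rewrite raddfD addrA; apply: in_idealD; last by apply: in_ideal_lwedge; apply: IH.
have := in_idealZ (v y)^-1 (kdiff_total y u).
rewrite scalerDr scaler_sumr -lwedgeZx -/(dlog (v y)) -/p addrC.
congr (in_ideal (_ + _)); apply: eq_bigr => i _.
by rewrite scalerA /dlog_coef rmorphM fmorphV mulrC.
Qed.

End RelativeForms.

Section Slots.
Variables (F : fieldType) (char2 : 2%N \in [pchar F]).
Variables (N : nat) (c : 'I_N -> F).

(** These are the classes that vanish over the extension of [F] by the square roots
    of the [c j]. *)
Definition slotted k (w : Omega F k.+1) : Prop :=
  exists h : 'I_N -> Omega F k, kmc char2 w = \sum_j kmc char2 (lwedge k (dlog (c j)) (h j)).

Lemma slotted_eq0 k (w : Omega F k.+1) : kmc char2 w = 0 -> slotted w.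
Proof.
by move=> w0; exists (fun=> 0); rewrite w0 big1 // => j _; rewrite raddf0 kmc0.
Qed.

Lemma slottedD k (w z : Omega F k.+1) : slotted w -> slotted z -> slotted (w + z).
Proof.
move=> [h wh] [h' zh]; exists (fun j => h j + h' j).
rewrite kmcD wh zh -big_split; apply: eq_bigr => j _.
by rewrite raddfD kmcD.
Qed.

Lemma slotted_ideal k (w : Omega F k.+1) : in_ideal c w -> slotted w.
Proof. by move=> [h ->]; exists h; rewrite kmc_sum. Qed.

Variables (K : fieldType) (v : {rmorphism K -> F}) (m : nat) (g : grading K 'I_m).
Variable b : 'I_m -> K.
Hypothesis b0 : forall i, b i != 0.
Hypothesis gen : forall (A : {set 'I_m}) x i, i \in A -> g A x != 0 -> generator g b i.
Hypothesis gE : forall (A : {set 'I_m}) y,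
  exists2 e, constant c e & v (g A y) = e * \prod_(i in A) v (b i).

(** Relative form of Kato's theorem: the symbols of a sum of Pfister forms that is
    equal to [[1, f]] in the Witt group relative to the [c j] add up to zero modulo
    the [dlog (c j)]. *)
Lemma nul_slotted k (ss : seq (K * seq K)) (r : seq (K * K)) (f : K) :
  (forall s, s \in ss -> size s.2 = k.+1 /\ all (fun y => y != 0) s.2) ->
  alt g (fun A => tensor_of g r A ^+ 2 + tensor_of g r A +
    (tensor_of g (flatten [seq pfister s.1 s.2 | s <- ss]) A + tau g (1, f) A)) ->
  slotted (\sum_(s <- ss) v s.1 *: wedges k.+1 [seq dlog (v y) | y <- s.2]).
Proof.
move=> ssP al; have Kc : 2%N \in [pchar K] by rewrite -(fmorph_pchar v).
set l := flatten _ in al *.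
have hatlE I : hat_list g l I = \sum_(s <- ss) hat_list g (pfister s.1 s.2) I.
  rewrite /l; elim: (ss) => [|s ss' IH] /=; first by rewrite big_nil /hat_list big_nil.
  by rewrite hatl_cat big_cons IH.
have low (I : {set 'I_m}) : (#|I| < k.+1)%N -> hat (tensor_of g l) I = 0.
  move=> Ik; rewrite hat_tsum hatlE big_seq big1 // => s /ssP[sk s0].
  by apply: (pf_low Kc) => //; rewrite sk.
have slead : slotted (leading v g b k.+1 l).
  rewrite /leading; have E I : hat_list g l I = hat (tensor_of g l) I by rewrite hat_tsum.
  under eq_bigr do rewrite E.
  apply: (nul_leading Kc gen (S := fun y I => v y *: basis_form v b k.+1 I)
    (N := @slotted k) _ _ _ _ _ al low).
  - by move=> x y I; rewrite rmorphD scalerDl.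
  - by apply: slotted_eq0; apply: kmc0.
  - by move=> w z; apply: slottedD.
  - move=> a I Ik; have [t t0 tE] := basis_form_dlog v b0 Ik.
    apply: slotted_eq0; rewrite tE rmorphD rmorphXn /= -[X in _ + X](oppr_pchar2 char2).
    exact: kmc_wp.
  - move=> C J x C0 Jk; have [t t0 tE] := basis_form_dlog v b0 Jk.
    have := kdiff_homog char2 b0 gE C x (basis_form v b k J).
    have -> : \sum_(i in C) v (g C x) *: lwedge k (dlog (v (b i))) (basis_form v b k J) =
        \sum_(i in C :\: J) v (g C x) *: basis_form v b k.+1 (i |: J).
      rewrite big_mkcond [RHS]big_mkcond; apply: eq_bigr => i _; rewrite inE andbC.
      case: (i \in C) => //=; rewrite (basis_formS char2) //.
      by case: (i \in J); rewrite ?scaler0.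
    set z := lwedge _ _ _; set w := \sum_(i in _) _ => /slotted_ideal zw.
    have -> : w = z + (z + w) by rewrite addrA Omega_addKK // add0r.
    apply: slottedD zw; apply: slotted_eq0.
    by rewrite /z -[basis_form _ _ _ _]scale1r tE; apply: kmc_kdiff.
have -> : \sum_(s <- ss) v s.1 *: wedges k.+1 [seq dlog (v y) | y <- s.2] =
    leading v g b k.+1 l + (leading v g b k.+1 l +
      \sum_(s <- ss) v s.1 *: wedges k.+1 [seq dlog (v y) | y <- s.2]).
  by rewrite addrA Omega_addKK // add0r.
apply: slottedD => //; apply: slotted_ideal.
have -> : leading v g b k.+1 l = \sum_(s <- ss) leading v g b k.+1 (pfister s.1 s.2).
  rewrite /leading exchange_big /=; apply: eq_bigr => I _.
  by rewrite hatlE rmorph_sum scaler_suml.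
rewrite -big_split big_seq; apply: (big_ind (@in_ideal F N c k.+1)).
- exact: in_ideal0.
- exact: in_idealD.
by move=> s /ssP[sk s0]; rewrite -sk; apply: leading_pf.
Qed.

End Slots.

(** * Reduction in the Witt group *)

Section WittEquality.
Variables (K : fieldType) (char2 : 2%N \in [pchar K]).
Variables (m : nat) (g : grading K 'I_m).
Implicit Types (f : {set 'I_m} -> K) (a e x y : K).

(** Equality in the Witt group: modulo alternating tensors, the square of the tensor
    of [r] is the sum of the [a (x) a e^2] for the pairs [(a, e)] in [r]. *)
Definition weq f f' :=
  exists r, alt g (fun A => tensor_of g r A ^+ 2 + tensor_of g r A + (f A + f' A)).

Lemma weq_alt f f' : alt g (fun A => f A + f' A) -> weq f f'.
Proof.
move=> af; exists [::]; apply: alt_eq af => A.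
by rewrite /tensor_of big_nil expr0n /= !add0r.
Qed.

Lemma weq_eq f f' : f =1 f' -> weq f f'.
Proof.
move=> ff'; apply: weq_alt; apply: (alt_eq _ (alt0 g)) => A.
by rewrite ff' addKK.
Qed.

Lemma weq_sum f1 f2 f1' f2' : weq f1 f1' -> weq f2 f2' ->
  weq (fun A => f1 A + f2 A) (fun A => f1' A + f2' A).
Proof.
move=> [r1 a1] [r2 a2]; exists (r1 ++ r2); apply: alt_eq (alt_add a1 a2) => A.
by rewrite /= tsum_cat sqrD //; ring.
Qed.

Lemma weq_trans f1 f2 f3 : weq f1 f2 -> weq f2 f3 -> weq f1 f3.
Proof.
move=> [r1 a1] [r2 a2]; exists (r1 ++ r2); apply: alt_eq (alt_add a1 a2) => A.
rewrite /= tsum_cat sqrD //.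
transitivity (tensor_of g r1 A ^+ 2 + tensor_of g r2 A ^+ 2 + (tensor_of g r1 A + tensor_of g r2 A) +
  (f1 A + f3 A) + (f2 A + f2 A)); first by ring.
by rewrite addKK // addr0.
Qed.

Lemma weq_sym f f' : weq f f' -> weq f' f.
Proof. by move=> [r a]; exists r; apply: alt_eq a => A; rewrite [f A + _]addrC. Qed.

Lemma weq_swap a e : weq (tau g (a, e)) (tau g (e, a)).
Proof. exact/weq_alt/tau_swap. Qed.

Lemma weq_frob a e : weq (tau g (a, a * e ^+ 2)) (tau g (a, e)).
Proof.
exists [:: (a, e)]; apply: alt_eq (tau_frob char2 g a e) => A.
rewrite /tensor_of big_seq1; set u := tau g (a, e) A; set z := tau g _ A.
transitivity (u ^+ 2 + z + (u + u)); last by ring.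
by rewrite addKK // addr0.
Qed.

(** The binary form [q] is isometric to [[value q w, covalue q w]] by a change of
    basis that takes the nonzero vector [w] as first vector. *)
Definition value (q w : K * K) := q.1 * w.1 ^+ 2 + w.1 * w.2 + q.2 * w.2 ^+ 2.
Definition covalue (q w : K * K) :=
  if w.2 == 0 then q.2 / w.1 ^+ 2 else q.1 / w.2 ^+ 2.

Lemma weq_value q w : w != (0, 0) -> weq (tau g q) (tau g (value q w, covalue q w)).
Proof.
case: q w => [a e] [x y]; rewrite xpair_eqE /value /covalue /=.
case: (y =P 0) => [->|/eqP y0].
  rewrite andbT => x0; rewrite mulr0 expr0n mulr0 !addr0; apply: weq_eq => A.
  by rewrite tau_bal // mulrCA divff ?mulr1 // expf_neq0.
move=> _; pose z := x / y.
have -> : a * x ^+ 2 + x * y + e * y ^+ 2 = (a * z ^+ 2 + z + e) * y ^+ 2.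
  by rewrite /z; field.
apply: (weq_trans (f2 := tau g (a * z ^+ 2 + z + e, a))); last first.
  by apply: weq_eq => A; rewrite tau_bal // [y ^+ 2 * _]mulrC divfK // expf_neq0.
apply: weq_sym; apply: weq_trans (weq_swap _ _) _.
have E A : tau g (a, a * z ^+ 2 + z + e) A =
    (tau g (a, a * z ^+ 2) A + tau g (a, z) A) + tau g (a, e) A.
  by rewrite !tauDr.
apply: weq_trans (weq_eq E) _.
have [r ar] := weq_frob a z.
exists r; apply: alt_eq ar => A; congr (_ + _).
set u := tau g (a, e) A; transitivity (tau g (a, a * z ^+ 2) A + tau g (a, z) A + (u + u)).
  by rewrite addKK // addr0.
by ring.
Qed.

End WittEquality.

Definition vmap (K F : fieldType) (v : K -> F) (p : K * K) := (v p.1, v p.2).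

(** The tensors of a sum of binary forms over [F] depend on a graded subfield [K]
    which is chosen after the reduction; equality is required over every [K] that
    contains the elements used by the reduction. *)
Definition wequiv (F : fieldType) (l l' : seq (F * F)) : Prop :=
  exists L : seq F, forall (K : fieldType) (v : {rmorphism K -> F}) (m : nat)
    (g : grading K 'I_m), (forall x, x \in L -> exists y, v y = x) ->
  forall k k', map (vmap v) k = l -> map (vmap v) k' = l' -> weq g (tensor_of g k) (tensor_of g k').

Section WittReduction.
Variables (F : fieldType) (char2 : 2%N \in [pchar F]).
Implicit Types (l : seq (F * F)).

Lemma vmap_inj (K : fieldType) (v : {rmorphism K -> F}) : injective (vmap v).
Proof. by move=> [a e] [a' e'] [/fmorph_inj -> /fmorph_inj ->]. Qed.

Lemma sub_char2 (K : fieldType) (v : {rmorphism K -> F}) : 2%N \in [pchar K].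
Proof. by rewrite -(fmorph_pchar v). Qed.

Lemma wequiv_perm l l' : perm_eq l l' -> wequiv l l'.
Proof.
move=> ll'; exists [::] => K v m g _ k k' kl kl'; apply: (weq_eq (sub_char2 v)) => A.
apply: perm_big; apply: (perm_map_inj (@vmap_inj K v)).
by rewrite kl kl'.
Qed.

Lemma lift_seq (K : fieldType) (v : {rmorphism K -> F}) l :
  (forall x, x \in [seq p.1 | p <- l] ++ [seq p.2 | p <- l] -> exists y, v y = x) ->
  exists k, map (vmap v) k = l.
Proof.
elim: l => [|[a e] l IH] H; first by exists [::].
have [|k kl] := IH.
  move=> x xl; apply: H; rewrite mem_cat !inE.
  by move: xl; rewrite mem_cat => /orP[]->; rewrite !orbT.
have [a' aa'] := H a (mem_head _ _).
have [e' ee'] : exists y, v y = e by apply: H; rewrite mem_cat !inE eqxx !orbT.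
by exists ((a', e') :: k); rewrite /= kl /vmap /= aa' ee'.
Qed.

Lemma wequiv_trans l2 l1 l3 : wequiv l1 l2 -> wequiv l2 l3 -> wequiv l1 l3.
Proof.
move=> [L H] [L' H']; exists (L ++ L' ++ [seq p.1 | p <- l2] ++ [seq p.2 | p <- l2]).
move=> K v m g im k1 k3 kl1 kl3.
have [|k2 kl2] := @lift_seq K v l2.
  by move=> x xl; apply: im; rewrite !mem_cat -mem_cat xl !orbT.
apply: (weq_trans (sub_char2 v) (f2 := tensor_of g k2)).
  by apply: (H K v m g) => // x xL; apply: im; rewrite mem_cat xL.
by apply: (H' K v m g) => // x xL; apply: im; rewrite !mem_cat xL orbT.
Qed.

Lemma wequiv_cat l1 l2 l1' l2' : wequiv l1 l1' -> wequiv l2 l2' ->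
  wequiv (l1 ++ l2) (l1' ++ l2').
Proof.
have split_map (K : fieldType) (v : {rmorphism K -> F}) k l l' :
    map (vmap v) k = l ++ l' -> exists k1 k2, [/\ k = k1 ++ k2,
      map (vmap v) k1 = l & map (vmap v) k2 = l'].
  move=> kE; exists (take (size l) k), (drop (size l) k); split.
  - by rewrite cat_take_drop.
  - by rewrite map_take kE take_size_cat.
  - by rewrite map_drop kE drop_size_cat.
move=> [L H] [L' H']; exists (L ++ L') => K v m g im k k'.
move=> /split_map[k1 [k2 [-> kl1 kl2]]] /split_map[k1' [k2' [-> kl1' kl2']]].
apply: (weq_trans (sub_char2 v) (f2 := fun A => tensor_of g k1 A + tensor_of g k2 A)).
  by apply: (weq_eq (sub_char2 v)) => A; rewrite tsum_cat.
apply: (weq_trans (sub_char2 v) (f2 := fun A => tensor_of g k1' A + tensor_of g k2' A)); last first.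
  by apply: (weq_eq (sub_char2 v)) => A; rewrite tsum_cat.
apply: (weq_sum (sub_char2 v)).
  by apply: (H K v m g) => // x xL; apply: im; rewrite mem_cat xL.
by apply: (H' K v m g) => // x xL; apply: im; rewrite mem_cat xL orbT.
Qed.

Lemma wequiv_value (q w : F * F) : w != (0, 0) ->
  wequiv [:: q] [:: (value q w, covalue q w)].
Proof.
move=> w0; exists [:: w.1; w.2] => K v m g im.
have [x xw] := im w.1 (mem_head _ _).
have [y yw] : exists y, v y = w.2 by apply: im; rewrite !inE eqxx orbT.
have ww : w = vmap v (x, y) by case: (w) xw yw => ? ? /= <- <-.
move=> [|[a e] []] //= k' [qE] k'E.
have -> : k' = [:: (value (a, e) (x, y), covalue (a, e) (x, y))].
  apply: (inj_map (@vmap_inj K v)); rewrite k'E -qE ww /vmap /=; congr [:: (_, _)].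
    by rewrite /value /= !(rmorphD, rmorphXn, rmorphM).
  rewrite /covalue /= -(fmorph_eq0 v y).
  by case: ifP => _; rewrite fmorph_div rmorphXn.
have t1 p : weq g (tensor_of g [:: p]) (tau g p).
  by apply: (weq_eq (sub_char2 v)) => A; rewrite /tensor_of big_seq1.
apply: (weq_trans (sub_char2 v) (t1 _)).
apply: (weq_trans (sub_char2 v) _ (weq_sym (t1 _))).
apply: (weq_value (sub_char2 v)).
by apply: contraNneq w0 => xy0; rewrite ww xy0 /vmap /= rmorph0.
Qed.

(** The first coefficient of [q] is the sum of the others, and [[a, e]] is additive
    in [a] and in [e] in the Witt group. *)
Lemma wequiv_merge (q : F * F) l : q.1 + \sum_(p <- l) p.1 = 0 ->
  wequiv (q :: l) [seq (p.1, p.2 + q.2) | p <- l].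
Proof.
move=> q0; exists [::] => K v m g _ [|p k] //= k' [pE kE] k'E.
apply: (weq_eq (sub_char2 v)) => A.
have -> : k' = [seq (r.1, r.2 + p.2) | r <- k].
  apply: (inj_map (@vmap_inj K v)); rewrite k'E -kE -pE -!map_comp.
  by apply: eq_map => r; rewrite /vmap /= rmorphD.
have p1E : p.1 = \sum_(r <- k) r.1.
  apply: (eq_addr0 (sub_char2 v)); apply: (fmorph_inj v).
  by rewrite rmorph0 rmorphD rmorph_sum /=; move: q0; rewrite -kE -pE big_map.
rewrite /tensor_of big_map big_cons /tau /= p1E gr_sumr mulr_suml -big_split /=.
by apply: eq_bigr => r _; rewrite mulrDr addrC.
Qed.

Section Bound.
Variable U : nat.
Hypothesis U_bound : forall m (q : 'rV[F]_m -> F),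
  quadratic_form q -> nonsingular q -> anisotropic q -> (m <= U)%N.

Lemma isotropic_vector l : (U < size l)%N ->
  exists2 w : seq (F * F), size w = size l /\ has (fun p => p != (0, 0)) w &
    \sum_(d <- zip l w) value d.1 d.2 = 0.
Proof.
move=> Ul; set M := size l in Ul *.
pose p (i : 'I_M) := nth (0, 0) l i.
pose X (u : 'rV[F]_(M + M)) i := u 0 (lshift M i).
pose Y (u : 'rV[F]_(M + M)) i := u 0 (rshift M i).
pose q u := \sum_i value (p i) (X u i, Y u i).
pose B u w := \sum_i (X u i * Y w i + Y u i * X w i).
have qB u w : polar q u w = B u w.
  rewrite /polar /q -!sumrB; apply: eq_bigr => i _.
  rewrite /value /X /Y !mxE /= !sqrD //; ring.
have qq : quadratic_form q.
  split=> [a u|a u s w].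
    rewrite /q mulr_sumr; apply: eq_bigr => i _; rewrite /value /X /Y !mxE /=; ring.
  rewrite !qB /B mulr_sumr -big_split; apply: eq_bigr => i _.
  rewrite /X /Y !mxE /=; ring.
have qn : nonsingular q.
  move=> u u0.
  have X0 i : X u i = 0.
    rewrite -(u0 (delta_mx 0 (rshift M i))) qB /B (bigD1 i) //= big1 => [|j ji].
      by rewrite /X /Y !mxE !eqxx eq_lrshift /= mulr0 mulr1 !addr0.
    by rewrite /X /Y !mxE eq_lrshift eq_rshift (negPf ji) !mulr0 addr0.
  have Y0 i : Y u i = 0.
    rewrite -(u0 (delta_mx 0 (lshift M i))) qB /B (bigD1 i) //= big1 => [|j ji].
      by rewrite /X /Y !mxE !eqxx eq_rlshift /= mulr0 mulr1 add0r addr0.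
    by rewrite /X /Y !mxE eq_rlshift eq_lshift (negPf ji) !mulr0 addr0.
  apply/rowP => i; rewrite mxE; case: (split_ordP i) => j ->; [exact: X0|exact: Y0].
have /existsNP[u /not_implyP[qu u0]] : ~ anisotropic q.
  move=> qa; have := U_bound qq qn qa; rewrite leqNgt => /negP; apply.
  exact: leq_trans Ul (leq_addr _ _).
exists [seq (X u i, Y u i) | i <- enum 'I_M].
  split; first by rewrite size_map size_enum_ord.
  apply/negP => /negP /hasPn W; apply: u0; apply/rowP => i; rewrite mxE.
  have W' j : (X u j, Y u j) = (0, 0).
    apply/eqP; rewrite -[_ == _]negbK; apply: W.
    by apply: (map_f (fun i => (X u i, Y u i))); rewrite mem_enum.
  by case: (split_ordP i) => j ->; have [] := W' j.
have lE : l = [seq p i | i <- enum 'I_M].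
  apply: (@eq_from_nth _ (0, 0)); first by rewrite size_map size_enum_ord.
  move=> i iM; rewrite (nth_map (Ordinal iM)) ?size_enum_ord //.
  by rewrite /p nth_enum_ord.
by rewrite lE zip_map big_map big_enum.
Qed.

(** A sum of more than [U] binary forms has an isotropic vector; taking its nonzero
    components as first basis vectors of their planes makes the first coefficients
    sum to zero, and [wequiv_merge] removes a plane. *)
Lemma witt_reduction l : exists2 l', (size l' <= U)%N & wequiv l l'.
Proof.
elim: {l}(size l) {-2}l (leqnn (size l)) => [|n IH] l ln.
  by exists l; [apply: leq_trans ln _|apply: wequiv_perm].
case: (leqP (size l) U) => [lU|Ul]; first by exists l => //; apply: wequiv_perm.
have [w [wl wnz] w0] := isotropic_vector Ul.
pose nz (d : F * F * (F * F)) := d.2 != (0, 0).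
pose ds := [seq d <- zip l w | nz d]; pose l0 := [seq d.1 | d <- zip l w & ~~ nz d].
have lds : wequiv l ([seq d.1 | d <- ds] ++ l0).
  apply: wequiv_perm; rewrite -map_cat -{1}(@unzip1_zip _ _ l w) ?wl //.
  by apply: perm_map; rewrite perm_sym perm_filterC.
have ds0 : \sum_(d <- ds) value d.1 d.2 = 0.
  rewrite -[RHS]w0 [RHS](bigID nz) /= big_filter [X in _ + X]big1 ?addr0 // => d.
  by rewrite negbK => /eqP d0; rewrite /value d0 /= expr0n /= !mulr0 !addr0.
have dsnz : all nz ds by apply: filter_all.
have sl : size l = (size ds + size l0)%N.
  have /perm_size := permEl (perm_filterC nz (zip l w)).
  by rewrite size_cat size_zip wl minnn size_map => ->.
case dsE : ds ds0 dsnz lds sl => [|d ds'] ds0 dsnz lds sl.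
  have /hasP[x xw x0] := wnz.
  have : x \in unzip2 (zip l w) by rewrite unzip2_zip ?wl.
  move=> /mapP[d dlw xd]; have : d \in ds by rewrite mem_filter /nz -xd x0.
  by rewrite dsE.
pose val (d : F * F * (F * F)) := (value d.1 d.2, covalue d.1 d.2).
have chg ds1 : all nz ds1 -> wequiv [seq d.1 | d <- ds1] [seq val d | d <- ds1].
  elim: ds1 => [|d1 ds1 IH1] /=; first by move=> _; apply: wequiv_perm.
  move=> /andP[n1 /IH1 w1]; rewrite -cat1s -[X in wequiv _ X]cat1s.
  by apply: wequiv_cat => //; apply: wequiv_value.
pose l1 := [seq (p.1, p.2 + (val d).2) | p <- [seq val d | d <- ds']] ++ l0.
have l1n : (size l1 <= n)%N.
  by move: ln; rewrite sl /l1 size_cat !size_map /=; lia.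
have [l' l'U l1l'] := IH l1 l1n; exists l' => //.
apply: wequiv_trans lds _; apply: wequiv_trans l1l'.
apply: wequiv_cat; last exact: wequiv_perm.
apply: wequiv_trans (chg _ dsnz) _ => /=; apply: wequiv_merge.
by rewrite big_map -[RHS]ds0 big_cons.
Qed.

End Bound.
End WittReduction.

(** * Symbol length *)

Section SymbolLength.
Variables (F : fieldType) (char2 : 2%N \in [pchar F]).

Lemma kmc_surj k (x : kato_milne char2 k.+1) : exists w, x = kmc char2 w.
Proof.
exists (repr (repr x)); rewrite /kmc /kato_milne_class /mod_exact.
by rewrite (reprK (repr x : Omega_mod_exact F k)) reprK.
Qed.

Lemma vmap_pf (K : fieldType) (v : {rmorphism K -> F}) alpha ys :
  map (vmap v) (pfister alpha ys) = pfister (v alpha) (map v ys).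
Proof.
elim: ys => [|y ys IH] /=; first by rewrite /vmap /= rmorph1.
rewrite map_cat IH -IH -!map_comp; congr (_ ++ _).
by apply: eq_map => p; rewrite /vmap /= rmorphM fmorph_div.
Qed.

Section Bound.
Variable U : nat.
Hypothesis U_bound : forall m (q : 'rV[F]_m -> F),
  quadratic_form q -> nonsingular q -> anisotropic q -> (m <= U)%N.

(** The Pfister forms of the symbols of [x] reduce to [[c_1, e_1] + ... + [c_U, e_U]],
    which is [[1, f]] over any graded field in which the [c_j] are constants. *)
Lemma bounded_slots k (x : kato_milne char2 k.+2) :
  exists (c : 'I_U -> F) (h : 'I_U -> Omega F k),
    x = \sum_j kmc char2 (lwedge k (dlog (c j)) (h j)).
Proof.
have [w ->] := kmc_surj x; have [r [e [he we]]] := Omega_decomposable w.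
have /choice[s sP] i : exists s : F * seq F,
    [/\ size s.2 = k.+1, all (fun y => y != 0) s.2 &
        e i = s.1 *: wedges k.+1 [seq dlog y | y <- s.2]].
  have [a [t [t0 ->]]] := he i; exists (a, [seq t j | j <- enum 'I_k.+1]); split=> /=.
  - by rewrite size_map size_enum_ord.
  - by apply/allP => y /mapP[j _ ->].
  - rewrite /dlog_form wedges_ffun -map_comp; congr (_ *: wedges _ _).
    by apply: eq_map => j; rewrite ffunE.
have [ss ssE] : exists ss, ss = [seq s i | i <- enum 'I_r] by eexists.
have [l' l'U [L HL]] := witt_reduction char2 U_bound (flatten [seq pfister t.1 t.2 | t <- ss]).
pose c (j : 'I_U) := (nth (0, 0) l' j).1; exists c.
pose L' := L ++ flatten [seq t.1 :: t.2 | t <- ss] ++ [seq p.1 | p <- l'] ++ [seq p.2 | p <- l'].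
have [K [v [m [g [b [im cE gen b0 gE]]]]]] := frame_exists char2
  (@constantD F U c) (@constantM F U c) (constant_sqr char2 c) L'.
have /choice[vi viP] y : exists z, y \in L' -> v z = y.
  case: (pselect (y \in L')) => [/im[z <-]|nL]; first by exists z.
  by exists 0 => /nL.
have [|k' k'l'] := @lift_seq F K v l'.
  by move=> y yl; apply: im; rewrite mem_cat [X in _ || X]mem_cat yl !orbT.
pose ssK := [seq (vi t.1, map vi t.2) | t <- ss].
have ssL t y : t \in ss -> y \in t.1 :: t.2 -> v (vi y) = y.
  move=> tss yt; apply: viP; rewrite mem_cat [X in _ || X]mem_cat; apply/orP; right.
  by apply/orP; left; apply/flattenP; exists (t.1 :: t.2) => //; apply: map_f.
have ssLs t : t \in ss -> map v (map vi t.2) = t.2.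
  move=> tss; rewrite -map_comp -[RHS]map_id; apply/eq_in_map => y yt /=.
  by apply: ssL tss _; rewrite inE yt orbT.
have lK : map (vmap v) (flatten [seq pfister t.1 t.2 | t <- ssK]) =
    flatten [seq pfister t.1 t.2 | t <- ss].
  rewrite map_flatten -!map_comp; congr flatten; apply/eq_in_map => t tss /=.
  by rewrite vmap_pf (ssL t) ?mem_head // ssLs.
have imL y : y \in L -> exists z, v z = y.
  by move=> yL; apply: im; rewrite mem_cat yL.
have [rr al] := HL K v m g imL _ _ lK k'l'.
pose f := \sum_(p <- k') p.1 * p.2.
have k'f A : tensor_of g k' A = tau g (1, f) A.
  have gk p B : p \in k' -> g B p.1 = (B == set0)%:R * p.1.
    move=> pk; suff p0 : g set0 p.1 = p.1.
      by rewrite -{1}p0 gr_gr; case: eqP => [->|_]; rewrite ?mul1r ?mul0r ?p0.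
    have /nthP : vmap v p \in l' by rewrite -k'l'; apply: map_f.
    move=> /(_ (0, 0))[j jl jE].
    have [y yp y0] := cE _ (constant_c c (Ordinal (leq_trans jl l'U))).
    suff -> : p.1 = y by [].
    by apply: (fmorph_inj v); rewrite yp /c /= jE.
  rewrite /tensor_of /tau /= (gr1 (sub_char2 char2 v)) /f mulr_sumr.
  by apply: eq_big_seq => p pk; rewrite gk // mulrA.
have := @nul_slotted F char2 U c K v m g b b0 gen gE k ssK rr f.
case.
- move=> _ /mapP[t tss ->] /=; have [i _ ti] : exists2 i, i \in enum 'I_r & t = s i by apply/mapP; rewrite -ssE.
  have [tk t0 _] := sP i; rewrite size_map ti tk; split=> //.
  apply/allP => y yt; rewrite -(fmorph_eq0 v).
  have : v y \in map v (map vi t.2) by apply: map_f; rewrite ti.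
  by rewrite ssLs // ti => /(allP t0).
- by apply: alt_eq al => A; rewrite k'f.
move=> h; rewrite big_map big_seq.
rewrite (eq_bigr (fun t => t.1 *: wedges k.+1 [seq dlog y | y <- t.2])) => [E|t tss].
  exists h; rewrite -E -big_seq ssE big_map big_enum we; congr kmc.
  by apply: eq_bigr => i _; have [_ _] := sP i.
rewrite /= (ssL t) ?mem_head //; congr (_ *: wedges _ _).
by rewrite -[in RHS](ssLs t tss) -!map_comp.
Qed.

Lemma expressible0 k : expressible (0 : kato_milne char2 k) 0.
Proof. by exists (fun=> 0); split=> [[]|] //; rewrite big_ord0. Qed.

Lemma expressibleD k (x y : kato_milne char2 k) r s :
  expressible x r -> expressible y s -> expressible (x + y) (r + s).
Proof.
move=> [e [he ->]] [e' [he' ->]].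
exists (fun i => match fintype.split i with inl j => e j | inr j => e' j end); split.
  by move=> i; case: (fintype.split i).
rewrite big_split_ord /=; congr (_ + _); apply: eq_bigr => i _.
  by rewrite -[lshift _ _]/(unsplit (inl i)) unsplitK.
by rewrite -[rshift _ _]/(unsplit (inr i)) unsplitK.
Qed.

Definition bounded k B :=
  forall x : kato_milne char2 k.+1, exists2 r, (r <= B)%N & expressible x r.

Lemma bounded0 : bounded 0 1.
Proof.
move=> x; have [w ->] := kmc_surj x; pose t : {ffun 'I_0 -> F} := [ffun=> 0].
have [a [wa _]] := Omega0_basis t w.
exists 1%N => //; exists (fun=> w); split; last by rewrite big_ord1.
move=> _; exists a, t; split=> [[]|] //.
by rewrite dlog_formE big_ord0 mulr1.
Qed.

Lemma lwedge_expressible k c (w : Omega F k) r :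
  expressible (kmc char2 w) r -> expressible (kmc char2 (lwedge k (dlog c) w)) r.
Proof.
move=> [e [he we]]; exists (fun i => lwedge k (dlog c) (e i)); split=> [i|].
  have [a [t [t0 ->]]] := he i; rewrite lwedge_dlog_form.
  have [->|c0] := eqVneq c 0; last by exists a, (fcons c t); split=> //; apply: fcons_neq0.
  exists 0, (fcons 1 t); split; first by apply: fcons_neq0 => //; apply: oner_neq0.
  by rewrite -!lwedge_dlog_form dlog0 lwedge0x /dlog_form scale0r raddf0.
have kmcB i (y z : Omega F i) : kmc char2 (y - z) = kmc char2 y - kmc char2 z.
  by rewrite /kmc raddfB.
have z0 : kmc char2 (w - \sum_i e i) = 0.
  by rewrite kmcB kmc_sum [X in X - _]we subrr.
have := kmc_lwedge c z0; rewrite raddfB raddf_sum /= kmcB kmc_sum.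
by move/eqP; rewrite subr_eq0 => /eqP.
Qed.

Lemma boundedS k B : bounded k B -> bounded k.+1 (U * B).
Proof.
move=> kB x; have [c [h ->]] := bounded_slots x.
rewrite -[U in (U * B)%N]card_ord -sum_nat_const.
elim/big_rec2: _ => [|j B' y _ [r rB' ry]]; first by exists 0; rewrite ?leqnn //; apply: expressible0.
have [s sB hs] := kB (kmc char2 (h j)).
exists (s + r)%N; first exact: leq_add.
by apply: expressibleD => //; apply: lwedge_expressible.
Qed.

Lemma bounded_exists k : exists B, bounded k B.
Proof.
elim: k => [|k [B kB]]; first by exists 1%N; apply: bounded0.
by exists (U * B)%N; apply: boundedS.
Qed.

End Bound.

Lemma nat_sup_fin (A : classical_sets.set nat) :
  nat_sup A <> +oo%E <-> exists B, forall r, A r -> (r <= B)%N.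
Proof.
rewrite /nat_sup; case: pselect => [bA|nbA]; split=> //.
- by move=> _; case: bA => B /asboolP AB; exists B => r /AB.
- by move=> [B AB]; case: nbA; exists B; apply/asboolP => r /AB.
Qed.

End SymbolLength.

Theorem mainTheorem2 (F : fieldType) (char2 : 2%N \in [pchar F]) :
  u_invariant F <> +oo%E ->
  forall n : nat, (0 < n)%N -> sl2 char2 n <> +oo%E.
Proof.
move=> /nat_sup_fin[U UB] [//|k] _; apply/nat_sup_fin.
have [|B kB] := @bounded_exists F char2 U _ k.
  by move=> m q qq qn qa; apply: UB; exists q.
exists B => _ [x _ <-]; have [r rB xr] := kB x.
rewrite /symbol_length; case: ex_minnP => s _ smin; apply: leq_trans rB.
by apply: smin; apply/asboolP.
Qed.
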